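(* Let $k\geqslant 1$ be an integer and let $\rho\in L^1(0,1)$ be a non-negative function which is not zero almost everywhere. Let $\Lambda(k,\rho)$ be defined by $$\frac{1}{\Lambda(k,\rho)}=\inf_{\substack{u\in H^k_0(0,1)\\ u\neq 0}}\frac{\left(\int_0^1|u^{(k)}(x)|^2\,dx\right)^{1/2}}{\int_0^1|u(x)|\rho(x)\,dx}.\qquad ( * )$$ Consider the problem of finding a real number $\mu$ and a real-valued function $u$ on $[0,1]$ such that $$(-1)^k u^{(2k)}(x)=\mu\,\rho(x)\,\operatorname{sign}(u(x)),\quad x\in[0,1],$$ $$\int_0^1|u(x)|\rho(x)\,dx=1,\qquad u^{(j)}(0)=u^{(j)}(1)=0\quad (0\leqslant j\leqslant k-1).\qquad ( ** )$$ Call $\mu$ an eigenvalue if $( ** )$ has a solution $u$ for this $\mu$, and call such a $u$ an eigenfunction for $\mu$. Then: 1. There is exactly one real number $\mu$ that admits an eigenfunction $u$ with $u>0$ on $(0,1)$, and this positive eigenfunction is unique. 2. This $\mu$ is the smallest eigenvalue of $( ** )$. 3. The infimum in $( * )$ is attained, and its minimizers are exactly the nonzero constant multiples of this positive eigenfunction; in particular every minimizer has a constant sign on $(0,1)$. 4. $\mu=\left(\dfrac{1}{\Lambda(k,\rho)}\right)^2$.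
   Context: Functions are real-valued. $H^k_0(0,1)$ denotes the space of all $u\in H^k(0,1)$ (the $L^2$-based Sobolev space of order $k$) with $u^{(j)}(0)=u^{(j)}(1)=0$ for $0\leqslant j\leqslant k-1$. In the infimum, quotients with zero denominator are interpreted as $+\infty$. The function $\operatorname{sign}$ takes the values $1,0,-1$ for positive, zero and negative arguments respectively. A solution $u$ of the problem is a function in $C^{2k-1}([0,1])$ whose derivative $u^{(2k-1)}$ is absolutely continuous on $[0,1]$, with the differential equation holding for almost every $x\in[0,1]$. *)

(* Defs.v *)
From HB Require Import structures.
From mathcomp Require Import all_boot all_order all_algebra.
From mathcomp Require Import all_classical all_reals all_analysis.

Set Implicit Arguments.
Unset Strict Implicit.
Unset Printing Implicit Defensive.

Import Order.TTheory GRing.Theory Num.Theory.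
Import numFieldNormedType.Exports.

Local Open Scope classical_set_scope.
Local Open Scope ring_scope.

(* A function on [0, 1] is represented by a total function R -> R whose values
   outside [0, 1] are irrelevant: differentiation, continuity and absolute
   continuity below only look at the restriction to [0, 1].  Two such functions
   are identified when they agree at every point of [0, 1]. *)

Definition diff_quotient01 (R : realType) (f : R -> R) (x : R)
  : set_system R :=
  (fun y : R => (f y - f x) / (y - x)) @ within `[0, 1] x^'.

(* One-sided differentiability at the endpoints 0 and 1. *)
Definition derivable01 (R : realType) (f : R -> R) (x : R) : Prop :=
  cvg (diff_quotient01 f x).

(* Meaningful at x only when derivable01 f x holds. *)
Definition deriv01 (R : realType) (f : R -> R) (x : R) : R :=
  lim (diff_quotient01 f x).

Definition nderiv01 (R : realType) (n : nat) (f : R -> R) : R -> R :=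
  iter n (@deriv01 R) f.

Definition Cn01 (R : realType) (n : nat) (f : R -> R) : Prop :=
  (forall j : nat, (j < n)%N -> forall x : R, 0 <= x <= 1 ->
     derivable01 (nderiv01 j f) x) /\
  {within `[0, 1], continuous (nderiv01 n f)}.

Definition abs_cont01 (R : realType) (f : R -> R) : Prop :=
  forall e : R, 0 < e -> exists2 d : R, 0 < d &
    forall (n : nat) (a b : 'I_n -> R),
      (forall i, [/\ 0 <= a i, a i <= b i & b i <= 1]) ->
      trivIset [set: 'I_n] (fun i => `]a i, b i[%classic) ->
      \sum_(i < n) (b i - a i) < d ->
      \sum_(i < n) `|f (b i) - f (a i)| < e.

(* Lebesgue spaces on (0, 1); lebesgue_measure lives on the Borel sets, so each
   class is represented by a Borel function. *)
Definition L1_01 (R : realType) (f : R -> R) : Prop :=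
  (@lebesgue_measure R).-integrable `]0, 1[ (EFin \o f).

Definition L2_01 (R : realType) (f : R -> R) : Prop :=
  measurable_fun (`]0, 1[ : set R) f /\ L1_01 (fun x => f x ^+ 2).

(* H^k(0, 1), k >= 1, each class being represented by its continuous
   representative, which is the one whose boundary values are meant below. *)
Definition Hk (R : realType) (k : nat) (u : R -> R) : Prop :=
  [/\ Cn01 k.-1 u, abs_cont01 (nderiv01 k.-1 u) & L2_01 (nderiv01 k u)].

Definition boundary_conditions (R : realType) (k : nat) (u : R -> R) : Prop :=
  forall j : nat, (j < k)%N -> nderiv01 j u 0 = 0 /\ nderiv01 j u 1 = 0.

Definition Hk0 (R : realType) (k : nat) (u : R -> R) : Prop :=
  Hk k u /\ boundary_conditions k u.

Definition nonzero01 (R : realType) (u : R -> R) : Prop :=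
  exists2 x : R, 0 <= x <= 1 & u x != 0.

Definition weighted_norm (R : realType) (rho u : R -> R) : R :=
  \int[@lebesgue_measure R]_(x in `]0, 1[) (`|u x| * rho x).

Definition norm_quotient (R : realType) (k : nat) (rho u : R -> R) : \bar R :=
  if weighted_norm rho u == 0 then +oo%E
  else (Num.sqrt
          (\int[@lebesgue_measure R]_(x in `]0, 1[) (`|nderiv01 k u x| ^+ 2))
        / weighted_norm rho u)%:E.

Definition inf_quotient (R : realType) (k : nat) (rho : R -> R) : \bar R :=
  ereal_inf [set norm_quotient k rho u | u in [set u | Hk0 k u /\ nonzero01 u]].

Definition Lambda (R : realType) (k : nat) (rho : R -> R) : \bar R :=
  ((inf_quotient k rho)^-1)%E.

Definition is_minimizer (R : realType) (k : nat) (rho u : R -> R) : Prop :=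
  [/\ Hk0 k u, nonzero01 u & norm_quotient k rho u = inf_quotient k rho].

Definition is_eigenfunction (R : realType) (k : nat) (rho : R -> R) (mu : R)
    (u : R -> R) : Prop :=
  [/\ Cn01 (2 * k).-1 u /\ abs_cont01 (nderiv01 (2 * k).-1 u),
      {ae @lebesgue_measure R, forall x : R, 0 <= x <= 1 ->
         derivable01 (nderiv01 (2 * k).-1 u) x /\
         (-1) ^+ k * nderiv01 (2 * k) u x = mu * rho x * Num.sg (u x)},
      weighted_norm rho u = 1 &
      boundary_conditions k u].

Definition is_eigenvalue (R : realType) (k : nat) (rho : R -> R) (mu : R) : Prop :=
  exists u : R -> R, is_eigenfunction k rho mu u.

Definition positive01 (R : realType) (u : R -> R) : Prop :=
  forall x : R, 0 < x < 1 -> 0 < u x.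

Definition negative01 (R : realType) (u : R -> R) : Prop :=
  forall x : R, 0 < x < 1 -> u x < 0.

(* Main.v *)
Require Import Defs.
From HB Require Import structures.
From mathcomp Require Import all_boot all_order all_algebra.
From mathcomp Require Import all_classical all_reals all_analysis measurable_realfun.
From mathcomp Require Import ring lra zify.

(** A positive eigenfunction satisfies a linear equation, because sign(u) is 1
    on (0, 1): (-1)^k u^(2k) = mu rho.  So let w solve (-1)^k w^(2k) = rho with
    the Dirichlet conditions, and let N be the integral of w rho (called
    [torsion]).  The normalisation leaves only u = w / N and mu = 1 / N, and
    the minimum problem reduces to an explicit inequality with equality for w.

    Take v in H^k_0 and let z solve the linear problem with right-hand side
    rho sign(v).  Integrating by parts k times ([dirichlet_solution_pairing]),
    the integral of |v| rho is that of v^(k) z^(k), and the energy of z, that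
    is the integral of (z^(k))^2, is the integral of z sign(v) rho.  By the
    comparison principle |z| <= w, so this energy is at most N, and the
    Cauchy-Schwarz inequality bounds the square of the integral of |v| rho by
    N times the energy of v ([sqr_weighted_norm_le]).  The function w gives
    equality.  Conversely, equality forces z = w or z = - w, since otherwise
    |z| < w on (0, 1), and then v^(k) is proportional to w^(k), so v to w
    ([weighted_norm_extremal]).  An eigenfunction v for nu has energy nu and
    satisfies the normalisation, so the same inequality reads nu >= 1 / N
    ([eigenvalue_ge]).

    The comparison principle says that the solution y for a nonnegative
    right-hand side is nonnegative, and positive on (0, 1) when the right-hand
    side is not almost everywhere zero ([dirichlet_solution_gt0]).  It comes
    from counting signs with Rolle's theorem.  If y had a negative value, each
    of its first k derivatives would show one sign more than the preceding one,
    because y, ..., y^(k-1) vanish at 0 and 1; each of the next k - 1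
    derivatives loses at most one sign, so (-1)^k y^(2k-1) would take a
    positive value and, further to the right, a negative one, although it is
    nondecreasing ([dirichlet_tower_ge0]).  An interior zero of y creates
    further signs and is excluded in the same way ([dirichlet_tower_eq0]).
    Uniqueness for the linear problem is a consequence; a solution is obtained
    by 2k successive integrations from 0, corrected by a polynomial multiple of
    X^k ([ex_hermite]).

    All integrations by parts rest on the fundamental theorem of calculus for
    absolutely continuous functions ([abs_cont01_density]).  Such a function is
    the difference of two nondecreasing ones, built from its total variation;
    their Stieltjes measures are dominated by Lebesgue measure, so they have
    Radon-Nikodym densities, and Lebesgue's differentiation theorem recovers
    the derivative from the density. *)

Set Implicit Arguments.
Unset Strict Implicit.
Unset Printing Implicit Defensive.

Import Order.TTheory GRing.Theory Num.Theory.
Import numFieldNormedType.Exports.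

Local Open Scope classical_set_scope.
Local Open Scope ring_scope.

(** * Derivatives on the closed unit interval *)

Section derivatives.
Context {R : realType}.
Implicit Types (f g h : R -> R) (x y l m c : R).

Definition has_deriv01 f x l : Prop := diff_quotient01 f x --> l.

Lemma dnbhs01_proper x : 0 <= x <= 1 ->
  ProperFilter (within (`[0, 1]%classic : set R) x^').
Proof.
move=> /andP[x0 x1]; apply: Build_ProperFilter_ex => /= P.
move=> [d /= d0 dP].
have [xh|hx] := leP x (1 / 2).
- exists (x + Num.min d (1 / 2) / 2).
  have m0 : 0 < Num.min d (1 / 2) by rewrite lt_min d0/=; lra.
  have md : Num.min d (1 / 2) <= d by rewrite ge_min lexx.
  have mh : Num.min d (1 / 2) <= 1 / 2 by rewrite ge_min lexx orbT.
  move: m0 md mh; set m := Num.min _ _ => m0 md mh.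
  apply: dP => /=.
  + rewrite opprD addrA subrr sub0r normrN ger0_norm; lra.
  + apply/eqP; lra.
  + rewrite in_itv/=; apply/andP; split; lra.
- exists (x - Num.min d (1 / 2) / 2).
  have m0 : 0 < Num.min d (1 / 2) by rewrite lt_min d0/=; lra.
  have md : Num.min d (1 / 2) <= d by rewrite ge_min lexx.
  have mh : Num.min d (1 / 2) <= 1 / 2 by rewrite ge_min lexx orbT.
  move: m0 md mh; set m := Num.min _ _ => m0 md mh.
  apply: dP => /=.
  + rewrite opprB addrC subrK ger0_norm; lra.
  + apply/eqP; lra.
  + rewrite in_itv/=; apply/andP; split; lra.
Qed.

Lemma has_deriv01P f x l : has_deriv01 f x l <->
  forall e, 0 < e -> exists2 d, 0 < d & forall y, 0 <= y <= 1 ->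
    `|y - x| < d -> `|f y - f x - l * (y - x)| <= e * `|y - x|.
Proof.
split.
- move=> /cvgrPdist_le fl e /fl [d /= d0 H]; exists d => // y y01 yxd.
  have [->|yx] := eqVneq y x; first by rewrite !subrr mulr0 subrr !normr0 mulr0.
  have yx0 : y - x != 0 by rewrite subr_eq0.
  rewrite -ler_pdivrMr ?normr_gt0// -normfV -normrM.
  have -> : (f y - f x - l * (y - x)) / (y - x) = (f y - f x) / (y - x) - l.
    by field.
  by rewrite distrC; apply: H => //=; rewrite distrC.
- move=> H; apply/cvgrPdist_le => e /H[d d0 {}H].
  exists d => //= y xyd yx y01.
  have yx0 : y - x != 0 by rewrite subr_eq0.
  have -> : l - (f y - f x) / (y - x) =
      - ((f y - f x - l * (y - x)) / (y - x)).
    by field.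
  rewrite normrN normrM normfV ler_pdivrMr ?normr_gt0//; apply: H => //.
  by rewrite distrC.
Qed.

Lemma has_deriv01_derivable f x l : has_deriv01 f x l -> derivable01 f x.
Proof. by move=> fl; apply/cvg_ex; exists l. Qed.

Lemma derivable01_has f x : derivable01 f x -> has_deriv01 f x (deriv01 f x).
Proof. by []. Qed.

Lemma has_deriv01E f x l : 0 <= x <= 1 -> has_deriv01 f x l -> deriv01 f x = l.
Proof.
by move=> x01 fl; have xF := dnbhs01_proper x01; apply: (cvg_lim _ fl).
Qed.

Lemma has_deriv01_eq f g x l : 0 <= x <= 1 ->
  (forall y, 0 <= y <= 1 -> f y = g y) ->
  has_deriv01 f x l -> has_deriv01 g x l.
Proof.
move=> x01 fg /has_deriv01P H; apply/has_deriv01P => e /H[d d0 {}H].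
by exists d => // y y01 yd; rewrite -!fg//; exact: H.
Qed.

Lemma deriv01_eq f g x : 0 <= x <= 1 ->
  (forall y, 0 <= y <= 1 -> f y = g y) -> deriv01 f x = deriv01 g x.
Proof.
move=> x01 fg; congr (lim _); rewrite eqEsubset; split => P H;
  by apply: (@filterS _ x^' _ _ _ _ H) => y /= + y01; rewrite !fg//; exact.
Qed.

Lemma has_deriv01_cst c x : has_deriv01 (fun=> c) x 0.
Proof.
apply/has_deriv01P => e e0; exists 1 => // y _ _.
by rewrite mul0r subrr subr0 normr0 mulr_ge0 // ltW.
Qed.

Lemma has_deriv01_id x : has_deriv01 id x 1.
Proof.
apply/has_deriv01P => e e0; exists 1 => // y _ _.
by rewrite mul1r subrr normr0 mulr_ge0 // ltW.
Qed.

Lemma has_deriv01D f g x l m : 0 <= x <= 1 ->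
  has_deriv01 f x l -> has_deriv01 g x m ->
  has_deriv01 (fun y => f y + g y) x (l + m).
Proof.
move=> x01 fl gm; have xF := dnbhs01_proper x01.
rewrite /has_deriv01 /diff_quotient01.
under eq_fun do rewrite opprD addrACA mulrDl.
exact: cvgD.
Qed.

Lemma has_deriv01Z c f x l : 0 <= x <= 1 ->
  has_deriv01 f x l -> has_deriv01 (fun y => c * f y) x (c * l).
Proof.
move=> x01 fl; have xF := dnbhs01_proper x01.
rewrite /has_deriv01 /diff_quotient01.
under eq_fun do rewrite -mulrBr -mulrA.
by apply: cvgM => //; exact: cvg_cst.
Qed.

Lemma has_deriv01_cvg f x l : 0 <= x <= 1 ->
  has_deriv01 f x l -> f y @[y --> within `[0, 1] (nbhs x)] --> f x.
Proof.
move=> x01 /has_deriv01P/(_ _ ltr01)[d d0 H].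
apply/cvgrPdist_le => e e0.
have M0 : 0 < 1 + `|l| by rewrite ltr_pwDl.
exists (Num.min d (e / (1 + `|l|))) => /=; first by rewrite lt_min d0 divr_gt0.
move=> y /=; rewrite lt_min distrC => /andP[yxd yxe] y01.
rewrite distrC.
have -> : f y - f x = (f y - f x - l * (y - x)) + l * (y - x) by rewrite subrK.
rewrite (le_trans (ler_normD _ _))// (le_trans (lerD (H _ y01 yxd) (lexx _)))//.
by rewrite normrM -mulrDl mulrC -ler_pdivlMr// ltW.
Qed.

Lemma has_deriv01M f g x l m : 0 <= x <= 1 ->
  has_deriv01 f x l -> has_deriv01 g x m ->
  has_deriv01 (fun y => f y * g y) x (l * g x + f x * m).
Proof.
move=> x01 fl gm; have xF := dnbhs01_proper x01.
rewrite /has_deriv01 /diff_quotient01.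
have -> : (fun y => (f y * g y - f x * g x) / (y - x)) =
    (fun y => (f y - f x) / (y - x) * g y + f x * ((g y - g x) / (y - x))).
  by apply/funext => y; rewrite mulrAC mulrA -mulrDl; congr (_ / _); ring.
apply: cvgD; last by apply: cvgM => //; exact: cvg_cst.
apply: cvgM => //.
apply: cvg_trans (has_deriv01_cvg x01 gm); apply: cvg_app.
by move=> P H; apply: (@filterS _ (nbhs x) _ _ _ _ H) => y /= + _; exact.
Qed.

Lemma is_derive_has_deriv01 f x l :
  is_derive x 1 f l -> has_deriv01 f x l.
Proof.
move=> [/cvg_ex[l' fl'] <-]; rewrite /derive (cvg_lim _ fl')//.
have {}fl' : (f (x + h) - f x) / h @[h --> (0 : R)^'] --> l'.
  apply: cvg_trans fl'; apply: near_eq_cvg; near=> h.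
  by rewrite /= /GRing.scale /= mulr1 mulrC [h + x]addrC.
move/cvgrPdist_le: fl' => fl'; apply/has_deriv01P => e /fl'.
move=> -[d /= d0 H]; exists d => // y y01 yx.
have [->|nyx] := eqVneq y x; first by rewrite !subrr mulr0 subrr !normr0 mulr0.
have yx0 : y - x != 0 by rewrite subr_eq0.
have := H (y - x); rewrite /= sub0r normrN => /(_ yx yx0).
rewrite [x + _]addrC subrK distrC => {}H.
have -> : f y - f x - l' * (y - x) = ((f y - f x) / (y - x) - l') * (y - x).
  by field.
by rewrite normrM ler_wpM2r.
Unshelve. all: by end_near. Qed.

Lemma has_deriv01_is_derive f x l : 0 < x < 1 ->
  has_deriv01 f x l -> is_derive x 1 f l.
Proof.
move=> /andP[x0 x1] fl.
suff H : (h^-1 *: (f (h *: 1 + x) - f x)) @[h --> (0 : R)^'] --> l.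
  split; first by apply/cvg_ex; exists l.
  exact: (cvg_lim _ H).
apply/cvgrPdist_le => e e0.
have /has_deriv01P/(_ _ e0)[d d0 {}fl] := fl.
exists (Num.min d (Num.min x (1 - x))) => /=.
  by rewrite !lt_min d0 x0 subr_gt0.
move=> h /=; rewrite sub0r normrN !lt_min => /and3P[hd hx h1] h0.
have := fl (h *: 1 + x); rewrite -[h *: 1]/(h * 1) mulr1 addrK => /(_ _ hd).
have -> : 0 <= h + x <= 1.
  by move: hx h1; rewrite !ltr_norml => /andP[? _] /andP[_ ?]; lra.
move=> /(_ isT) H.
rewrite [X in `|X|](_ : _ = - ((f (h + x) - f x - l * h) / h)); last first.
  by rewrite /GRing.scale /=; field.
by rewrite normrN normrM normfV ler_pdivrMr ?normr_gt0.
Qed.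

End derivatives.

(** * Absolute continuity *)

Section absolutely_continuous.
Context {R : realType}.
Implicit Types (f g h : R -> R) (x y c : R).

Lemma continuous01P f : {within `[0, 1], continuous f} <->
  forall x, 0 <= x <= 1 -> f y @[y --> within `[0, 1] (nbhs x)] --> f x.
Proof.
by split=> [/subspace_continuousP H x x01|H]; last apply/subspace_continuousP => x;
  [apply: H; rewrite /= in_itv|rewrite /= in_itv; exact: H].
Qed.

Lemma has_deriv01_continuous f f' :
  (forall x, 0 <= x <= 1 -> has_deriv01 f x (f' x)) ->
  {within `[0, 1], continuous f}.
Proof.
by move=> ff'; apply/continuous01P => x x01; exact: (has_deriv01_cvg x01 (ff' _ x01)).
Qed.

Lemma continuous01_eq f g : (forall x, 0 <= x <= 1 -> f x = g x) ->
  {within `[0, 1], continuous f} -> {within `[0, 1], continuous g}.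
Proof.
move=> fg cf; apply/(subspace_eq_continuous _ cf).
by move=> x /set_mem /=; rewrite in_itv /= => /fg.
Qed.

Lemma MVT01 f f' a b : 0 <= a -> a < b -> b <= 1 ->
  (forall x, 0 <= x <= 1 -> has_deriv01 f x (f' x)) ->
  exists2 c, a < c < b & f b - f a = f' c * (b - a).
Proof.
move=> a0 ab b1 ff'.
have [| |c] := @MVT _ f f' a b ab.
- move=> x; rewrite in_itv /= => /andP[ax xb].
  by apply: has_deriv01_is_derive; [lra|apply: ff'; lra].
- apply: continuous_subspaceW (has_deriv01_continuous ff') => x /=.
  by rewrite !in_itv /= => /andP[ax xb]; lra.
- by rewrite in_itv /=; exists c.
Qed.

Lemma continuous01_bounded f : {within `[0, 1], continuous f} ->
  exists2 M, 0 < M & forall x, 0 <= x <= 1 -> `|f x| <= M.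
Proof.
move=> cf; have [c c01 cM] := EVT_max ler01 cf.
have [d d01 dm] := EVT_min ler01 cf.
exists (1 + `|f c| + `|f d|).
  by rewrite -addrA ltr_pwDl// addr_ge0.
move=> x x01; have xI : x \in `[0, 1] by rewrite in_itv.
have := cM _ xI; have := dm _ xI; have := ler_norm (f c).
have := ler_norm (- f d); rewrite normrN ler_norml.
have := normr_ge0 (f c); have := normr_ge0 (f d).
lra.
Qed.

Lemma abs_cont01_eq f g : (forall x, 0 <= x <= 1 -> f x = g x) ->
  abs_cont01 f -> abs_cont01 g.
Proof.
move=> fg cf e /cf[d d0 H]; exists d => // n a b ab tr s.
have := H _ _ _ ab tr s; congr (_ < _); apply: eq_bigr => i _.
by have [? ? ?] := ab i; rewrite !fg//; lra.
Qed.

Lemma abs_cont01_continuous f : abs_cont01 f -> {within `[0, 1], continuous f}.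
Proof.
move=> cf; apply/continuous01P => x x01; apply/cvgrPdist_le => e /cf[d d0 H].
exists d => //= y xy; rewrite in_itv /= => y01.
have {}xy : `|x - y| < d by [].
wlog xley : x y x01 y01 xy / x <= y.
  move=> W; have [|/ltW] := leP x y; first exact: W.
  by rewrite distrC; apply: W => //; rewrite distrC.
rewrite distrC; apply/ltW.
have := H 1%N (fun=> x) (fun=> y); rewrite !big_ord1; apply.
- by move=> _; split; lra.
- by move=> i j _ _ _; rewrite !ord1.
- by rewrite -[y - x]ger0_norm ?subr_ge0// distrC.
Qed.

Lemma abs_cont01D f g : abs_cont01 f -> abs_cont01 g ->
  abs_cont01 (fun x => f x + g x).
Proof.
move=> cf cg e e0; have e20 : 0 < e / 2 by rewrite divr_gt0.
have [d1 d10 H1] := cf _ e20; have [d2 d20 H2] := cg _ e20.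
exists (Num.min d1 d2); first by rewrite lt_min d10.
move=> n a b ab tr; rewrite lt_min => /andP[/(H1 _ _ _ ab tr) h1 /(H2 _ _ _ ab tr) h2].
rewrite [e]splitr; apply: le_lt_trans (ltrD h1 h2); rewrite -big_split /=.
by apply: ler_sum => i _; rewrite opprD addrACA ler_normD.
Qed.

(** One estimate serves products, whose factors are bounded, and Lipschitz
    functions, which are dominated by the identity. *)
Lemma abs_cont01_dominated f g h M :
  0 < M -> abs_cont01 f -> abs_cont01 g ->
  (forall x y, 0 <= x <= 1 -> 0 <= y <= 1 ->
     `|h y - h x| <= M * (`|f y - f x| + `|g y - g x|)) ->
  abs_cont01 h.
Proof.
move=> M0 cf cg hfg e e0; have e20 : 0 < e / 2 / M by rewrite !divr_gt0.
have [d1 d10 H1] := cf _ e20; have [d2 d20 H2] := cg _ e20.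
exists (Num.min d1 d2); first by rewrite lt_min d10.
move=> n a b ab tr; rewrite lt_min => /andP[/(H1 _ _ _ ab tr) h1 /(H2 _ _ _ ab tr) h2].
have h3 := ltrD h1 h2; rewrite -mulrDl -splitr ltr_pdivlMr// in h3.
apply: le_lt_trans h3; rewrite -big_split /= mulrC mulr_sumr.
by apply: ler_sum => i _; have [? ? ?] := ab i; apply: hfg; lra.
Qed.

Lemma abs_cont01_lipschitz f K :
  (forall x y, 0 <= x <= 1 -> 0 <= y <= 1 -> `|f y - f x| <= K * `|y - x|) ->
  abs_cont01 f.
Proof.
move=> fK.
have cid : abs_cont01 (@id R).
  move=> e e0; exists e => // n a b ab tr; apply: le_lt_trans.
  apply: ler_sum => i _; rewrite ger0_norm// subr_ge0.
  by have [] := ab i.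
have M0 : 0 < 1 + `|K| by rewrite ltr_pwDl.
apply: (abs_cont01_dominated M0 cid cid) => x y x01 y01.
apply: le_trans (fK _ _ x01 y01) _.
apply: le_trans (ler_wpM2r _ (ler_norm K)) _ => //.
by rewrite ler_pM// ?lerDr// lerDl.
Qed.

Lemma abs_cont01M f g : abs_cont01 f -> abs_cont01 g ->
  abs_cont01 (fun x => f x * g x).
Proof.
move=> cf cg.
have [M M0 fM] := continuous01_bounded (abs_cont01_continuous cf).
have [N N0 gN] := continuous01_bounded (abs_cont01_continuous cg).
apply: (abs_cont01_dominated (addr_gt0 M0 N0) cf cg) => x y x01 y01.
have -> : f y * g y - f x * g x = (f y - f x) * g y + f x * (g y - g x) by ring.
apply: le_trans (ler_normD _ _) _; rewrite !normrM mulrDr lerD//.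
- by rewrite mulrC ler_wpM2r// (le_trans (gN _ y01))// lerDr ltW.
- by rewrite ler_wpM2r// (le_trans (fM _ x01))// lerDl ltW.
Qed.

Lemma abs_cont01_cst c : abs_cont01 (fun=> c).
Proof.
by apply: (@abs_cont01_lipschitz _ 0) => x y _ _; rewrite subrr normr0 mul0r.
Qed.

Lemma abs_cont01Z c f : abs_cont01 f -> abs_cont01 (fun x => c * f x).
Proof. exact/abs_cont01M/abs_cont01_cst. Qed.

Lemma C1_abs_cont01 f f' : {within `[0, 1], continuous f'} ->
  (forall x, 0 <= x <= 1 -> has_deriv01 f x (f' x)) -> abs_cont01 f.
Proof.
move=> cf' ff'; have [M M0 fM] := continuous01_bounded cf'.
apply: (@abs_cont01_lipschitz _ M) => x y x01 y01.
wlog xy : x y x01 y01 / x < y.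
  move=> W; have [|yx|->] := ltgtP x y; first exact: W.
    by rewrite distrC [`|y - x|]distrC; exact: W.
  by rewrite !subrr normr0 mulr0.
have [||c cxy ->] := @MVT01 f f' x y _ xy _ ff'; [lra|lra|].
by rewrite normrM ler_wpM2r//; apply: fM; lra.
Qed.

End absolutely_continuous.

(** * Total variation of an absolutely continuous function *)

Section total_variation.
Context {R : realType}.
Implicit Types (f g : R -> R) (s t : seq (R * R)) (l : seq R) (p q : R * R).

Definition nonoverlapping p q := (p.2 <= q.1) || (q.2 <= p.1).

Definition interval_family s : bool :=
  all (fun p => [&& 0 <= p.1, p.1 <= p.2 & p.2 <= 1]) s &&
  pairwise nonoverlapping s.

Definition total_length s : R := \sum_(p <- s) (p.2 - p.1).

Definition total_oscillation f s : R := \sum_(p <- s) `|f p.2 - f p.1|.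

(** The intervals are in a list because a list can be refined piece by piece,
    by induction; the last inequality is large so that it passes to the
    suprema defining the total variation. *)
Definition seq_abs_cont f : Prop :=
  forall e, 0 < e -> exists2 d, 0 < d &
    forall s, interval_family s -> total_length s < d ->
      total_oscillation f s <= e.

Lemma abs_cont01_seq f : abs_cont01 f -> seq_abs_cont f.
Proof.
move=> cf e /cf[d d0 H]; exists d => // s /andP[/allP s01 sd].
rewrite /total_length /total_oscillation !(big_nth (0, 0)) !big_mkord => sl.
apply/ltW/(H _ _ _ _ _ sl) => [i|i j _ _ [x []]].
  by have /s01/and3P[] := mem_nth (0, 0) (ltn_ord i).
rewrite /= !in_itv /= => /andP[ix xi] /andP[jx xj].
apply/val_inj/eqP; apply/negP => /negP ij.
wlog lij : i j ix xi jx xj ij / (i < j)%N.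
  move=> W; have := ij; rewrite neq_ltn => /orP[|]; first exact: W.
  by apply: W => //; rewrite eq_sym.
have /(pairwiseP (0, 0))/(_ i j (ltn_ord i) (ltn_ord j) lij) := sd.
by move=> /orP[]; lra.
Qed.

Lemma nonoverlapping_sym p q : nonoverlapping p q = nonoverlapping q p.
Proof. exact: orbC. Qed.

Lemma nonoverlappingS p q r : p.1 <= r.1 -> r.2 <= p.2 ->
  nonoverlapping p q -> nonoverlapping r q.
Proof.
by move=> pr rp /orP[pq|qp]; apply/orP; [left|right]; lra.
Qed.

Fixpoint gaps (a : R) l : seq (R * R) :=
  if l is b :: l' then (a, b) :: gaps b l' else [::].

Lemma gapsP a l : path <%R a l ->
  all (fun p => [&& a <= p.1, p.1 <= p.2 & p.2 <= last a l]) (gaps a l) /\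
  pairwise nonoverlapping (gaps a l).
Proof.
elim: l a => //= b l IH a /andP[ab /IH[/allP H ->]].
have bl : b <= last b l.
  case: l {IH} H => //= c l /(_ (b, c)); rewrite inE eqxx /= => /(_ isT).
  by move=> /and3P[_ bc /(le_trans bc)].
split.
  rewrite lexx (ltW ab) bl /=; apply/allP => p /H /and3P[bp -> ->].
  by rewrite (le_trans (ltW ab) bp).
by rewrite andbT; apply/allP => p /H /and3P[bp _ _]; rewrite /nonoverlapping /= bp.
Qed.

Lemma total_length_gaps a l : total_length (gaps a l) = last a l - a.
Proof.
rewrite /total_length; elim: l a => /= [a|b l IH a].
  by rewrite big_nil subrr.
by rewrite big_cons IH /=; ring.
Qed.

Lemma variation_gaps f a b l : itv_partition a b l ->
  variation a b f l = total_oscillation f (gaps a l).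
Proof.
move=> /variation_zip ->; rewrite /total_oscillation.
elim: l a => [a|c l IH a]; first by rewrite !big_nil.
by rewrite !big_cons -IH.
Qed.

(** Absolute continuity controls the total variations as well, because
    partitions of the intervals of a family form a family of the same length.
    The intervals are refined one at a time: [t] collects the pieces of those
    already treated, and a supremum is taken at each step. *)
Lemma sum_total_variation_le f e d :
  (forall s, interval_family s -> total_length s < d ->
     total_oscillation f s <= e) ->
  forall s t, interval_family (s ++ t) -> total_length (s ++ t) < d ->
    (\sum_(p <- s) total_variation p.1 p.2 f + (total_oscillation f t)%:E
       <= e%:E)%E.
Proof.
move=> H; elim=> [|[a b] s IH] t fam len.
  by rewrite big_nil add0e lee_fin; exact: H.
rewrite big_cons /=.
have := fam; rewrite /interval_family /= => /andP[/andP[/and3P[a0 ab b1] st01]].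
move=> /andP[/allP abst pst].
have fam' : interval_family (s ++ t) by rewrite /interval_family st01 pst.
have [->|nab] := eqVneq a b.
  rewrite total_variationxx add0e; apply: IH => //.
  apply: le_lt_trans len; rewrite /total_length /= big_cons /=.
  by rewrite lerDr subr_ge0.
have {nab}ab' : a < b by rewrite lt_neqAle nab.
set C := (\sum_(p <- s) _)%E.
have C0 : (0 <= C)%E.
  rewrite /C big_seq sume_ge0// => p ps; apply: total_variation_ge0.
  by have /allP/(_ p) := st01; rewrite mem_cat ps => /(_ isT)/and3P[].
have key l : itv_partition a b l ->
    (C + (total_oscillation f t + variation a b f l)%:E <= e%:E)%E.
  move=> lab; have := lab => -[pl /eqP lb].
  have [/allP gl gd] := gapsP pl; rewrite lb in gl.
  rewrite (variation_gaps f lab) [total_oscillation f t + _]addrC.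
  have -> : total_oscillation f (gaps a l) + total_oscillation f t =
      total_oscillation f (gaps a l ++ t) by rewrite /total_oscillation big_cat.
  have perm : perm_eq (s ++ gaps a l ++ t) (gaps a l ++ s ++ t).
    by rewrite perm_catCA.
  apply: IH.
  - rewrite /interval_family (perm_all _ perm) all_cat st01 andbT.
    apply/andP; split.
      apply/allP => p /gl /and3P[h1 h2 h3].
      by rewrite h2 (le_trans a0 h1) (le_trans h3 b1).
    have gst p q : p \in gaps a l -> q \in s ++ t -> nonoverlapping p q.
      move=> pg qst; have /and3P[h1 _ h3] := gl _ pg.
      exact: (@nonoverlappingS (a, b) _ _ h1 h3 (abst _ qst)).
    move: pst; rewrite !pairwise_cat allrel_catr gd => /and3P[-> -> ->].
    rewrite /= !andbT; apply/andP; split; apply/allrelP => p q.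
      move=> ps qg; rewrite nonoverlapping_sym.
      by apply: gst => //; rewrite mem_cat ps.
    by move=> pg qt; apply: gst => //; rewrite mem_cat qt orbT.
  - rewrite /total_length (perm_big _ perm) big_cat /= -!/(total_length _).
    rewrite total_length_gaps lb.
    by move: len; rewrite /total_length /= big_cons.
have tvab : (total_variation a b f <= (e - total_oscillation f t)%:E - C)%E.
  apply: ge_ereal_sup => _ [v [l lab <-] <-].
  have {}key := key l lab.
  have Cf : C \is a fin_num.
    rewrite ge0_fin_numE//; apply: le_lt_trans (ltry e).
    apply: le_trans key; rewrite leeDl// lee_fin.
    by rewrite addr_ge0 ?variation_ge0// sumr_ge0.
  rewrite leeBrDr//; move: key; rewrite -(fineK Cf) -!EFinD !lee_fin; lra.
have Cf : C \is a fin_num.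
  have := key [:: b] (itv_partition1 ab'); rewrite ge0_fin_numE// => k.
  apply: le_lt_trans (ltry e); apply: le_trans k; rewrite leeDl// lee_fin.
  by rewrite addr_ge0 ?variation_ge0// sumr_ge0.
move: tvab; rewrite leeBrDr// => tvab.
apply: (le_trans (leeD tvab (lexx _))).
by rewrite -EFinD lee_fin subrK.
Qed.

Lemma interval_family1 a b : 0 <= a -> a <= b -> b <= 1 ->
  interval_family [:: (a, b)].
Proof. by move=> a0 ab b1; rewrite /interval_family /= a0 ab b1. Qed.

(** The variation is at most 1 on each of finitely many short intervals. *)
Lemma seq_abs_cont_total_variation_fin f : seq_abs_cont f ->
  forall x, 0 <= x <= 1 -> total_variation 0 x f \is a fin_num.
Proof.
move=> /(_ _ ltr01)[d d0 /sum_total_variation_le H].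
have step a b : 0 <= a -> a <= b -> b <= 1 -> b - a < d ->
    total_variation a b f \is a fin_num.
  move=> a0 ab b1 bad; have := H [:: (a, b)] [::].
  rewrite /total_length /total_oscillation !big_cons !big_nil /= addr0 !adde0.
  rewrite ge0_fin_numE ?total_variation_ge0// => /(_ _ bad) h.
  by apply: le_lt_trans (h _) (ltry _); exact: interval_family1.
have main n x : 0 <= x <= 1 -> x <= n%:R * (d / 2) ->
    total_variation 0 x f \is a fin_num.
  elim: n x => [|n IH] x x01.
    rewrite mul0r => x0; have -> : x = 0 by lra.
    by rewrite total_variationxx.
  rewrite -natr1 mulrDl mul1r => xn.
  have [xd|dx] := leP x (d / 2); first by apply: step; lra.
  rewrite (@total_variationD _ 0 x (x - d / 2)); [|lra|lra].
  by rewrite fin_numD IH ?step//; lra.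
move=> x x01; apply: (main (Num.bound (x / (d / 2)))) => //.
rewrite -ler_pdivrMr ?divr_gt0//; apply/ltW/archi_boundP.
by case/andP: x01 => x0 _; rewrite !divr_ge0// ltW.
Qed.

Definition variation_fun f x : R := fine (total_variation 0 x f).

Lemma variation_funB f a b : seq_abs_cont f -> 0 <= a -> a <= b -> b <= 1 ->
  (variation_fun f b - variation_fun f a)%:E = total_variation a b f.
Proof.
move=> cf a0 ab b1; have fin := seq_abs_cont_total_variation_fin cf.
have fa : total_variation 0 a f \is a fin_num by apply: fin; lra.
have fb : total_variation 0 b f \is a fin_num by apply: fin; lra.
rewrite EFinB !fineK// (total_variationD f a0 ab) addeAC subee// add0e.
by [].
Qed.

Lemma variation_fun_ge f a b : seq_abs_cont f -> 0 <= a -> a <= b -> b <= 1 ->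
  `|f b - f a| <= variation_fun f b - variation_fun f a.
Proof.
by move=> cf a0 ab b1; rewrite -lee_fin variation_funB// total_variation_ge.
Qed.

Lemma variation_fun_seq_abs_cont f :
  seq_abs_cont f -> seq_abs_cont (variation_fun f).
Proof.
move=> cf e e0; have [d d0 /sum_total_variation_le H] := cf _ e0.
exists d => // s fam len; have := H s [::]; rewrite cats0 => /(_ fam len).
rewrite /total_oscillation big_nil adde0 -lee_fin; apply: le_trans; rewrite -sumEFin.
rewrite big_seq [leRHS]big_seq; apply: lee_sum => p ps.
have /andP[/allP/(_ _ ps)/and3P[p0 pp p1] _] := fam.
rewrite -variation_funB// lee_fin ger0_norm//.
exact: le_trans (normr_ge0 _) (variation_fun_ge cf p0 pp p1).
Qed.

Lemma seq_abs_contB f g : seq_abs_cont f -> seq_abs_cont g ->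
  seq_abs_cont (fun x => f x - g x).
Proof.
move=> cf cg e e0; have e20 : 0 < e / 2 by rewrite divr_gt0.
have [d1 d10 H1] := cf _ e20; have [d2 d20 H2] := cg _ e20.
exists (Num.min d1 d2); first by rewrite lt_min d10.
move=> s fam; rewrite lt_min => /andP[/(H1 _ fam) h1 /(H2 _ fam) h2].
rewrite [e]splitr; apply: le_trans (lerD h1 h2); rewrite -big_split /=.
apply: ler_sum => p _.
have -> : f p.2 - g p.2 - (f p.1 - g p.1) = (f p.2 - f p.1) - (g p.2 - g p.1).
  by ring.
exact: ler_normB.
Qed.

End total_variation.

(** * Absolutely continuous functions are integrals *)

Section monotone.
Context {R : realType}.
Implicit Types (f W : R -> R) (x y a b : R).
Notation leb := (@lebesgue_measure R).

(** Composing with this retraction of the line onto [0, 1] extends a function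
    by constants and keeps it continuous and monotone. *)
Definition clamp01 x : R := Num.max 0 (Num.min x 1).

Lemma clamp01P x : 0 <= clamp01 x <= 1.
Proof. by rewrite /clamp01 /Num.max /Num.min; repeat case: ifP; lra. Qed.

Lemma clamp01_id x : 0 <= x <= 1 -> clamp01 x = x.
Proof. by rewrite /clamp01 /Num.max /Num.min; repeat case: ifP; lra. Qed.

Lemma le_clamp01 x y : x <= y -> clamp01 x <= clamp01 y.
Proof. by rewrite /clamp01 /Num.max /Num.min; repeat case: ifP; lra. Qed.

Lemma clamp01_lip x y : x <= y -> clamp01 y - clamp01 x <= y - x.
Proof. by rewrite /clamp01 /Num.max /Num.min; repeat case: ifP; lra. Qed.

Lemma clamp01_le0 x : x <= 0 -> clamp01 x = 0.
Proof. by rewrite /clamp01 /Num.max /Num.min; repeat case: ifP; lra. Qed.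

(* The last clause places the empty interval at [m], away from the others. *)
Lemma open_bounded_interval (A : set R) m M : open A -> is_interval A ->
  A `<=` `]m, M[ ->
  exists p : R * R, [/\ p.1 <= p.2, A = `]p.1, p.2[%classic &
    A = set0 -> p.2 = m].
Proof.
move=> oA iA AmM; have [->|/set0P[x0 Ax0]] := eqVneq A set0.
  by exists (m, m); split=> //=; rewrite set_itv_ge// bnd_simp ltxx.
have hinf : has_inf A.
  by split; [exists x0|exists m => y /AmM /=; rewrite in_itv /= => /andP[/ltW]].
have hsup : has_sup A.
  by split; [exists x0|exists M => y /AmM /=; rewrite in_itv /= => /andP[_ /ltW]].
exists (inf A, sup A); split => /=.
- by apply: (@le_trans _ _ x0); [apply: ge_inf => //; case: hinf|apply: ub_le_sup => //; case: hsup].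
- apply/seteqP; split => y /=; rewrite in_itv /=.
  + move=> Ay; have [e /= e0 He] := oA _ Ay.
    have yl : A (y - e / 2).
      by apply: He => /=; rewrite opprB addrC subrK gtr0_norm; lra.
    have yr : A (y + e / 2).
      by apply: He => /=; rewrite opprD addrA subrr sub0r normrN gtr0_norm; lra.
    have := ge_inf hinf.2 yl; have := ub_le_sup hsup.2 yr; lra.
  + move=> /andP[iy ys].
    have [z Az zy] := inf_lt hinf.1 iy.
    have [t At yt] := sup_gt hsup.1 ys.
    by apply: (iA z t) => //; rewrite (ltW zy) (ltW yt).
- by move=> A0; rewrite A0 in Ax0.
Qed.

Section stieltjes.
Variable W : R -> R.
Hypothesis Wnd : forall x y, 0 <= x -> x <= y -> y <= 1 -> W x <= W y.
Hypothesis Wac : seq_abs_cont W.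

Let Wc := W \o clamp01.

Let Wc_nd : nondecreasing Wc.
Proof.
move=> x y xy; apply: Wnd; last by have /andP[] := clamp01P y.
- by have /andP[] := clamp01P x.
- exact: le_clamp01.
Qed.

Let Wc_rc : right_continuous Wc.
Proof.
apply: right_continuousW => x; apply/cvgrPdist_le => e /Wac[d d0 H].
exists d => //= y xy; have {}xy : `|x - y| < d by [].
wlog xley : x y xy / x <= y.
  move=> K; have [|/ltW] := leP x y; first exact: K.
  by rewrite distrC; apply: K; rewrite distrC.
have := H [:: (clamp01 x, clamp01 y)].
rewrite /total_length /total_oscillation !big_cons !big_nil /= !addr0 distrC.
apply.
- by apply: interval_family1; [have /andP[] := clamp01P x|exact: le_clamp01|
    have /andP[] := clamp01P y].
- apply: le_lt_trans (clamp01_lip xley) _.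
  by apply: le_lt_trans (ler_norm _) _; rewrite distrC.
Qed.

Definition stieltjes_cumulative : cumulative R R :=
  HB.pack_for (cumulative R R) Wc (isCumulative.Build R _ R Wc Wc_nd Wc_rc).

Definition stieltjes := lebesgue_stieltjes_measure stieltjes_cumulative.

HB.instance Definition _ := Measure.on stieltjes.

Lemma stieltjes_itv a b : a <= b ->
  stieltjes `]a, b]%classic = (W (clamp01 b) - W (clamp01 a))%:E.
Proof.
move=> ab; rewrite /stieltjes /lebesgue_stieltjes_measure /measure_extension.
by rewrite measurable_mu_extE/= ?wlength_itv_bnd//; exact: is_ocitv.
Qed.

(** The components of an open set, once retracted into [0, 1], are a family to
    which the absolute continuity of [W] applies; their union has the sum of
    their Stieltjes measures as its measure. *)
Lemma stieltjes_small e : 0 < e -> exists2 d, 0 < d & forall U : set R,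
  open U -> U `<=` `]-2, 2[ -> (leb U < d%:E)%E -> (stieltjes U <= e%:E)%E.
Proof.
move=> /Wac[d d0 H]; exists d => // U oU U2 Ud.
pose I := open_disjoint_itv oU.
have IU n : I n `<=` U.
  by rewrite [X in _ `<=` X](open_disjoint_itv_bigcup oU) => x Ix; exists n.
have mI n : measurable (I n).
  by apply: open_measurable; exact: open_disjoint_itv_open.
have trivI : trivIset setT I by exact: open_disjoint_itv_trivIset.
have /choice[p pP] : forall n, exists p : R * R,
    [/\ p.1 <= p.2, I n = `]p.1, p.2[%classic & I n = set0 -> p.2 = -2].
  move=> n; apply: (@open_bounded_interval _ _ 2).
  - exact: open_disjoint_itv_open.
  - exact: open_disjoint_itv_is_interval.
  - exact: subset_trans (IU n) U2.
pose c n := (clamp01 (p n).1, clamp01 (p n).2).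
have fam n : interval_family [seq c i | i <- index_iota 0 n].
  apply/andP; split.
    apply/allP => _ /mapP[i _ ->] /=; have [/le_clamp01 -> _ _] := pP i.
    by have /andP[-> _] := clamp01P (p i).1; have /andP[_ ->] := clamp01P (p i).2.
  (* empty components are sent to the endpoint 0, which overlaps nothing *)
  rewrite pairwise_map; have := iota_uniq 0 (n - 0); rewrite uniq_pairwise.
  apply: sub_pairwise => i j /= ij; rewrite /nonoverlapping /c /=.
  have empty k : I k = set0 -> clamp01 (p k).2 = 0.
    by have [_ _ /[apply] ->] := pP k; apply: clamp01_le0; lra.
  have [/empty ->|/set0P[x Ix]] := eqVneq (I i) set0.
    by have /andP[->] := clamp01P (p j).1.
  have [/empty ->|/set0P[y Iy]] := eqVneq (I j) set0.
    by have /andP[? _] := clamp01P (p i).1; apply/orP; right.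
  have [ij'|ji] := leP (p i).2 (p j).1; first by rewrite le_clamp01.
  have [ji'|ij''] := leP (p j).2 (p i).1; first by apply/orP; right; exact: le_clamp01.
  have /trivIsetP/(_ i j Logic.I Logic.I ij)/seteqP[+ _] := trivI.
  have [_ Ei _] := pP i; have [_ Ej _] := pP j.
  move: Ix Iy; rewrite Ei Ej /= !in_itv /= => /andP[? ?] /andP[? ?].
  move=> /(_ ((Num.max (p i).1 (p j).1 + Num.min (p i).2 (p j).2) / 2)) [].
  rewrite /= !in_itv /= /Num.max /Num.min.
  by case: ifP; case: ifP; lra.
have part n : (\sum_(i < n) stieltjes (I i) <= e%:E)%E.
  apply: (@le_trans _ _ (total_oscillation W [seq c i | i <- index_iota 0 n])%:E).
    rewrite /total_oscillation big_map big_mkord -sumEFin.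
    apply: lee_sum => i _; have [ple -> _] := pP i.
    apply: (@le_trans _ _ (stieltjes `](p i).1, (p i).2]%classic)).
      rewrite le_measure ?inE//.
      by apply: subset_itvl; rewrite bnd_simp.
    by rewrite stieltjes_itv// lee_fin ler_norm.
  rewrite lee_fin; apply: H => //.
  rewrite -lte_fin; apply: le_lt_trans Ud.
  apply: (@le_trans _ _ (leb (\big[setU/set0]_(i < n) I i))).
    rewrite measure_semi_additive//; last first.
      by apply: bigsetU_measurable => i _; exact: mI.
    rewrite /total_length big_map big_mkord -sumEFin.
    apply: lee_sum => i _; have [ple -> _] := pP i.
    rewrite [leRHS]lebesgue_measure_itv /= lte_fin.
    case: ltP => [_|ge]; first by rewrite -EFinB lee_fin clamp01_lip.
    have -> : (p i).1 = (p i).2 by apply/eqP; rewrite eq_le ple ge.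
    by rewrite subrr.
  rewrite le_measure ?inE//.
  - by apply: bigsetU_measurable => i _; exact: mI.
  - exact: open_measurable.
  - by rewrite -bigcup_mkord; apply: bigcup_sub => i _; exact: IU.
rewrite [X in stieltjes X](open_disjoint_itv_bigcup oU) -/I.
rewrite measure_semi_bigcup//; last first.
  by apply: bigcup_measurable => i _; exact: mI.
apply: lime_le; first exact: is_cvg_nneseries.
by apply: nearW => n; rewrite big_mkord; exact: part.
Qed.

Let mD : @measurable _ (measurableTypeR R) `]-1, 1]%classic.
Proof. exact: measurable_itv. Qed.

Let stieltjesD_fin : (stieltjes `]-1, 1]%classic%R < +oo)%E.
Proof. by rewrite stieltjes_itv ?ltry//; lra. Qed.

(** A finite measure with the same increments on [0, 1]. *)
Definition stieltjes01 := mfrestr mD stieltjesD_fin.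

HB.instance Definition _ := FiniteMeasure.on stieltjes01.

(** By outer regularity a null set lies in open sets of small length, and
    these have small Stieltjes measure. *)
Lemma stieltjes01_dominated : stieltjes01 `<< leb.
Proof.
apply/null_content_dominatesP => A mA A0.
apply/eqP; rewrite eq_le measure_ge0 andbT; apply/lee_addgt0Pr => e e0.
rewrite add0e; have [d d0 H] := stieltjes_small e0.
have [|U [oU AU UA]] := lebesgue_regularity_outer mA _ d0.
  by rewrite [X in (X < _)%E]A0.
have oI : open (`]-2, 2[%classic : set R) by exact: interval_open.
have oUI : open (U `&` `]-2, 2[) by exact: openI.
rewrite /stieltjes01 /mfrestr /mrestr; apply: (@le_trans _ _ (stieltjes (U `&` `]-2, 2[))).
  rewrite le_measure ?inE//.
  - exact: (@measurableI _ (measurableTypeR R) A _ mA mD).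
  - exact: (@open_measurable _ _ oUI).
  - apply: setISS => // x /=; rewrite !in_itv /=; lra.
apply: H => //.
have mU : measurable U by exact: open_measurable.
apply: (@le_lt_trans _ _ (leb U)).
  rewrite le_measure ?inE//.
  exact: (@open_measurable _ _ oUI).
rewrite -(setDUK AU); apply: le_lt_trans (measureU2 _ _ _) _ => //.
  exact: (@measurableD _ (measurableTypeR R) U A mU mA).
by rewrite [X in (X + _)%E]A0 add0e.
Qed.

Lemma monotone_density : exists2 h : R -> R,
  leb.-integrable [set: R] (EFin \o h) &
  forall x, 0 <= x <= 1 -> W x - W 0 = \int[leb]_(t in `[0, x]) h t.
Proof.
have [g [g0 gfin ig gE]] := radon_nikodym_sigma_finite stieltjes01_dominated.
have gh : EFin \o (fine \o g) = g by apply/funext => x /=; rewrite fineK.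
exists (fine \o g); first by rewrite gh.
move=> x x01; have x0 : 0 <= x by lra.
rewrite -Rintegral_itv_obnd_cbnd; last first.
  by rewrite gh; apply: (integrableS measurableT) => //; exact: measurable_itv.
rewrite /Rintegral; under eq_integral => t _ do rewrite /= fineK//.
rewrite -gE; last exact: measurable_itv.
rewrite [X in fine X](_ : _ = stieltjes `]0, x]%classic); last first.
  rewrite /= /stieltjes01 /mfrestr /mrestr setIidl// => y /=; rewrite !in_itv /=; lra.
rewrite stieltjes_itv//= !clamp01_id//; lra.
Qed.

End stieltjes.

(** Jordan decomposition: the variation function V and V - f are nondecreasing
    and absolutely continuous, so each has a Radon-Nikodym density. *)
Lemma abs_cont01_density f : abs_cont01 f -> exists2 h : R -> R,
  leb.-integrable [set: R] (EFin \o h) &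
  forall x, 0 <= x <= 1 -> f x = f 0 + \int[leb]_(t in `[0, x]) h t.
Proof.
move=> /abs_cont01_seq cf; have cV := variation_fun_seq_abs_cont cf.
have [||h1 ih1 h1E] := @monotone_density (variation_fun f).
- move=> x y x0 xy y1; rewrite -subr_ge0.
  exact: le_trans (normr_ge0 _) (variation_fun_ge cf x0 xy y1).
- by [].
have [||h2 ih2 h2E] := @monotone_density (fun x => variation_fun f x - f x).
- move=> x y x0 xy y1; rewrite -subr_ge0.
  have := le_trans (ler_norm _) (variation_fun_ge cf x0 xy y1); lra.
- exact: seq_abs_contB.
exists (fun x => h1 x - h2 x).
  rewrite (_ : _ \o _ = (EFin \o h1) \- (EFin \o h2))%E; last first.
    by apply/funext => x /=; rewrite EFinB.
  exact: integrableB.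
move=> x x01; have x0 : 0 <= x by lra.
rewrite RintegralB//; last 2 first.
- by apply: (integrableS measurableT) => //; exact: measurable_itv.
- by apply: (integrableS measurableT) => //; exact: measurable_itv.
rewrite -h1E// -h2E//; lra.
Qed.

Lemma integral_ae_deriv01 (h : R -> R) :
  leb.-integrable [set: R] (EFin \o h) ->
  {ae leb, forall x, 0 < x < 1 ->
     has_deriv01 (fun x => \int[leb]_(t in `[0, x]) h t) x (h x)}.
Proof.
move=> ih.
have ihy y : leb.-integrable [set` Interval (BLeft 0) (BRight y)] (EFin \o h).
  by apply: (integrableS measurableT) => //; exact: measurable_itv.
have := @FTC1 _ h (BLeft 0) ihy (open_integrable_locally openT ih).
apply: filterS; first exact: (ae_filter_ringOfSetsType leb).
move=> x H x01; have [|d1 d2] := H; first by rewrite /= lte_fin; lra.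
apply: is_derive_has_deriv01; apply: DeriveDef; first exact: d1.
by rewrite -derive1E; exact: d2.
Qed.

End monotone.

(** * Integration on the open unit interval *)

Section integration.
Context {R : realType}.
Implicit Types (f g h p q : R -> R) (x y c : R) (P Q S : R -> Prop).
Notation leb := (@lebesgue_measure R).

Definition ae01 P : Prop := {ae leb, forall x, 0 < x < 1 -> P x}.

Lemma ae01W P : (forall x, 0 < x < 1 -> P x) -> ae01 P.
Proof. by move=> H; rewrite /ae01; apply: aeW. Qed.

Lemma ae01S P Q : (forall x, 0 < x < 1 -> P x -> Q x) -> ae01 P -> ae01 Q.
Proof.
move=> PQ; apply: (@filterS _ _ (ae_filter_ringOfSetsType leb)).
by move=> x Px x01; apply: PQ => //; exact: Px.
Qed.

Lemma ae01S2 P Q S : (forall x, 0 < x < 1 -> P x -> Q x -> S x) ->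
  ae01 P -> ae01 Q -> ae01 S.
Proof.
move=> PQS; apply: (@filterS2 _ _ (ae_filter_ringOfSetsType leb)).
by move=> x Px Qx x01; apply: PQS => //; [exact: Px|exact: Qx].
Qed.

Definition int01 f : R := \int[leb]_(x in `]0, 1[) f x.

Lemma measurable01 : measurable (`]0, 1[%classic : set R).
Proof. exact: measurable_itv. Qed.
Hint Resolve measurable01 : core.

Lemma L1_01_measurable f : L1_01 f -> measurable_fun (`]0, 1[ : set R) f.
Proof. by move=> /integrableP[/measurable_EFinP]. Qed.

Lemma L1_01_eq f g : (forall x, 0 < x < 1 -> f x = g x) -> L1_01 f -> L1_01 g.
Proof.
move=> fg; apply: eq_integrable => // x; rewrite inE /= in_itv /= => x01.
by rewrite fg.
Qed.

Lemma L1_01D f g : L1_01 f -> L1_01 g -> L1_01 (fun x => f x + g x).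
Proof.
move=> If Ig; rewrite /L1_01.
rewrite (_ : _ \o _ = (EFin \o f) \+ (EFin \o g))%E; first exact: integrableD.
by apply/funext => x /=; rewrite EFinD.
Qed.

Lemma L1_01Z c f : L1_01 f -> L1_01 (fun x => c * f x).
Proof.
move=> If; rewrite /L1_01.
rewrite (_ : _ \o _ = (fun x => c%:E * (EFin \o f) x))%E; first exact: integrableZl.
by apply/funext => x /=; rewrite EFinM.
Qed.

Lemma L1_01N f : L1_01 f -> L1_01 (fun x => - f x).
Proof. by move=> /(L1_01Z (-1)); apply: L1_01_eq => x _; rewrite mulN1r. Qed.

Lemma L1_01B f g : L1_01 f -> L1_01 g -> L1_01 (fun x => f x - g x).
Proof. by move=> If /L1_01N; exact: L1_01D. Qed.

Lemma le_L1_01 f g : measurable_fun (`]0, 1[ : set R) f ->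
  (forall x, 0 < x < 1 -> `|f x| <= g x) -> L1_01 g -> L1_01 f.
Proof.
move=> mf fg; apply: le_integrable => //; first exact/measurable_EFinP.
move=> x; rewrite /= in_itv /= => /fg {}fg; rewrite lee_fin.
exact: le_trans fg (ler_norm _).
Qed.

Lemma continuous01_measurable f : {within `[0, 1], continuous f} ->
  measurable_fun (`]0, 1[ : set R) f.
Proof.
move=> cf.
have mf : measurable_fun (`[0, 1] : set R) f.
  by apply: subspace_continuous_measurable_fun => //; exact: measurable_itv.
apply: measurable_funS mf; [exact: measurable_itv|exact: subset_itv_oo_cc].
Qed.

Lemma L1_01M_continuous f g : L1_01 f -> {within `[0, 1], continuous g} ->
  L1_01 (fun x => f x * g x).
Proof.
move=> If cg; have [M M0 gM] := continuous01_bounded cg.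
apply: (@le_L1_01 _ (fun x => M * `|f x|)); last exact/L1_01Z/integrable_norm.
  apply: measurable_funM; first exact: L1_01_measurable.
  exact: continuous01_measurable.
by move=> x x01; rewrite normrM mulrC ler_wpM2r// gM//; lra.
Qed.

Lemma L1_01_cst c : L1_01 (fun=> c).
Proof.
apply: measurable_bounded_integrable => //.
  by rewrite [X in (X < _)%E]lebesgue_measure_itv /= lte_fin ltr01 ltry.
exists `|c|; split; first exact: num_real.
by move=> M cM x _; exact: ltW.
Qed.

Lemma L1_01_continuous f : {within `[0, 1], continuous f} -> L1_01 f.
Proof.
move=> /(L1_01M_continuous (L1_01_cst 1)).
by apply: L1_01_eq => x _; rewrite mul1r.
Qed.

Lemma eq_int01 f g : (forall x, 0 < x < 1 -> f x = g x) -> int01 f = int01 g.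
Proof.
by move=> fg; apply: eq_Rintegral => x; rewrite inE /= in_itv /=; exact: fg.
Qed.

Lemma int01D f g : L1_01 f -> L1_01 g ->
  int01 (fun x => f x + g x) = int01 f + int01 g.
Proof. exact: RintegralD. Qed.

Lemma int01B f g : L1_01 f -> L1_01 g ->
  int01 (fun x => f x - g x) = int01 f - int01 g.
Proof. exact: RintegralB. Qed.

Lemma int01Z c f : L1_01 f -> int01 (fun x => c * f x) = c * int01 f.
Proof. exact: RintegralZl. Qed.

Lemma ae01_ae_eq f g (i : interval R) : (forall x, x \in i -> 0 < x < 1) ->
  ae01 (fun x => f x = g x) -> ae_eq leb [set` i] (EFin \o f) (EFin \o g).
Proof.
move=> i01; apply: (@filterS _ _ (ae_filter_ringOfSetsType leb)).
by move=> x + xi; rewrite /= => ->//; exact: i01.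
Qed.

Lemma ae_eq_Rintegral01 f g (i : interval R) :
  (forall x, x \in i -> 0 < x < 1) -> L1_01 f -> L1_01 g ->
  ae01 (fun x => f x = g x) ->
  \int[leb]_(x in [set` i]) f x = \int[leb]_(x in [set` i]) g x.
Proof.
move=> i01 If Ig fg; congr fine; apply: ae_eq_integral.
- exact: measurable_itv.
- apply: measurable_funS (measurable_int _ If); first exact: measurable01.
  by move=> x /i01; rewrite /= in_itv.
- apply: measurable_funS (measurable_int _ Ig); first exact: measurable01.
  by move=> x /i01; rewrite /= in_itv.
- exact: ae01_ae_eq.
Qed.

Lemma ae_eq_int01 f g : L1_01 f -> L1_01 g ->
  ae01 (fun x => f x = g x) -> int01 f = int01 g.
Proof. by move=> If Ig fg; apply: (@ae_eq_Rintegral01 f g `]0, 1[) => // x; rewrite in_itv. Qed.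

Lemma int01_ge0 f : L1_01 f -> ae01 (fun x => 0 <= f x) -> 0 <= int01 f.
Proof.
move=> If f0; rewrite (@ae_eq_int01 f (fun x => `|f x|))//.
- exact: Rintegral_ge0.
- exact: integrable_norm.
- by apply: ae01S f0 => x _ /ger0_norm.
Qed.

Lemma le_int01 f g : L1_01 f -> L1_01 g -> ae01 (fun x => f x <= g x) ->
  int01 f <= int01 g.
Proof.
move=> If Ig fg; rewrite -subr_ge0 -int01B//; apply: int01_ge0.
  exact: L1_01B.
by apply: ae01S fg => x _; rewrite subr_ge0.
Qed.

Lemma int01_eq0 f : L1_01 f -> ae01 (fun x => 0 <= f x) -> int01 f = 0 ->
  ae01 (fun x => f x = 0).
Proof.
move=> If f0; rewrite (@ae_eq_int01 f (fun x => `|f x|))//; last 2 first.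
- exact: integrable_norm.
- by apply: ae01S f0 => x _ /ger0_norm.
move=> int0.
have : ae_eq leb `]0, 1[%classic (EFin \o f) (cst 0%E).
  apply/ae_eq_integral_abs => //; first exact: measurable_int If.
  have fin : (\int[leb]_(x in `]0%R, 1%R[) `|f x|%:E)%E \is a fin_num.
    by apply: integrable_fin_num => //; exact: integrable_norm If.
  by rewrite -(fineK fin); congr EFin.
apply: (@filterS _ _ (ae_filter_ringOfSetsType leb)).
by move=> x + x01; rewrite /= in_itv /= => /(_ x01)[].
Qed.

Lemma L2_01_L1 f : L2_01 f -> L1_01 f.
Proof.
move=> [mf If]; apply: le_L1_01 (L1_01D (L1_01_cst 1) If) => // x _.
rewrite -[f x ^+ 2]real_normK ?num_real//; nra.
Qed.

Lemma L2_01M f g : L2_01 f -> L2_01 g -> L1_01 (fun x => f x * g x).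
Proof.
move=> [mf If] [mg Ig]; apply: le_L1_01 (L1_01D If Ig).
  exact: measurable_funM.
move=> x _; rewrite normrM -[f x ^+ 2]real_normK ?num_real//.
by rewrite -[g x ^+ 2]real_normK ?num_real//; nra.
Qed.

Lemma L2_01_continuous f : {within `[0, 1], continuous f} -> L2_01 f.
Proof.
move=> cf; split; first exact: continuous01_measurable.
by apply: L1_01_eq (L1_01M_continuous (L1_01_continuous cf) cf) => x _; rewrite expr2.
Qed.

End integration.

(** * Absolutely continuous primitives *)

Section primitives.
Context {R : realType}.
Implicit Types (f g h p q : R -> R) (x y c : R).
Notation leb := (@lebesgue_measure R).

(** The common form of all steps between successive derivatives: a continuous
    derivative everywhere for the low orders, a density for the top one. *)
Definition ae_primitive f p : Prop :=
  [/\ abs_cont01 f, L1_01 p & ae01 (fun x => has_deriv01 f x (p x))].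

Lemma L1_01_integrableS p (i : interval R) : (forall x, x \in i -> 0 < x < 1) ->
  L1_01 p -> leb.-integrable [set` i] (EFin \o p).
Proof.
move=> i01; apply: integrableS; [exact: measurable01|exact: measurable_itv|].
by move=> x /i01; rewrite /= in_itv.
Qed.

(** The density of [f] and [p] are both derivatives of [f] almost everywhere,
    so they agree there. *)
Lemma ae_primitive_integral f p : ae_primitive f p ->
  forall x, 0 <= x <= 1 -> f x = f 0 + \int[leb]_(t in `]0, x[) p t.
Proof.
move=> [cf Ip fp] x x01; have [h ih hE] := abs_cont01_density cf.
have Ih : L1_01 h.
  by apply: integrableS ih => //; exact: measurable01.
have ph : ae01 (fun t => h t = p t).
  apply: ae01S2 fp (integral_ae_deriv01 ih) => t t01 ft ht.
  have t01' : 0 <= t <= 1 by lra.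
  have : has_deriv01 f t (0 + h t).
    apply: (@has_deriv01_eq _
      (fun x => f 0 + \int[leb]_(t in `[0, x]) h t)) => //.
      by move=> y y01; rewrite -hE.
    by apply: has_deriv01D => //; exact: has_deriv01_cst.
  by move=> /(has_deriv01E t01'); rewrite (has_deriv01E t01' ft) add0r.
have sub t : t \in `]0, x[ -> 0 < t < 1 by rewrite in_itv /=; lra.
rewrite hE//; congr (_ + _).
rewrite -(ae_eq_Rintegral01 sub Ih Ip ph) /Rintegral integral_itv_bndoo//.
apply: measurable_funS (measurable_int _ ih) => //.
Qed.

Lemma FTC01 f p : ae_primitive f p -> int01 p = f 1 - f 0.
Proof.
move=> /ae_primitive_integral/(_ 1); rewrite lexx ler01 => /(_ isT) ->.
by rewrite addrC addKr.
Qed.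

Lemma ae_primitive0_const f : ae_primitive f (fun=> 0) ->
  forall x, 0 <= x <= 1 -> f x = f 0.
Proof.
move=> /ae_primitive_integral fE x /fE ->.
by rewrite /Rintegral integral0 /= addr0.
Qed.

Lemma C1_ae_primitive f p : {within `[0, 1], continuous p} ->
  (forall x, 0 <= x <= 1 -> has_deriv01 f x (p x)) -> ae_primitive f p.
Proof.
move=> cp fp; split; first exact: C1_abs_cont01 fp.
- exact: L1_01_continuous.
- by apply: ae01W => x x01; apply: fp; lra.
Qed.

Lemma ae_primitive_eq f p q : ae_primitive f p -> L1_01 q ->
  ae01 (fun x => p x = q x) -> ae_primitive f q.
Proof.
move=> [cf _ fp] Iq pq; split=> //.
by apply: ae01S2 pq fp => x _ ->.
Qed.

Lemma ae_primitiveD f g p q : ae_primitive f p -> ae_primitive g q ->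
  ae_primitive (fun x => f x + g x) (fun x => p x + q x).
Proof.
move=> [cf Ip fp] [cg Iq gq]; split; [exact: abs_cont01D|exact: L1_01D|].
by apply: ae01S2 fp gq => x x01; apply: has_deriv01D; lra.
Qed.

Lemma ae_primitiveZ c f p : ae_primitive f p ->
  ae_primitive (fun x => c * f x) (fun x => c * p x).
Proof.
move=> [cf Ip fp]; split; [exact: abs_cont01Z|exact: L1_01Z|].
by apply: ae01S fp => x x01; apply: has_deriv01Z; lra.
Qed.

Lemma ae_primitive_continuous f p : ae_primitive f p ->
  {within `[0, 1], continuous f}.
Proof. by move=> [/abs_cont01_continuous]. Qed.

Lemma int01_by_parts f g p q : ae_primitive f p -> ae_primitive g q ->
  int01 (fun x => f x * q x) = f 1 * g 1 - f 0 * g 0 - int01 (fun x => p x * g x).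
Proof.
move=> fp gq; have [cf Ip fp'] := fp; have [cg Iq gq'] := gq.
have Ipg := L1_01M_continuous Ip (ae_primitive_continuous gq).
have Ifq : L1_01 (fun x => f x * q x).
  by apply: L1_01_eq (L1_01M_continuous Iq (ae_primitive_continuous fp)) => x _;
     rewrite mulrC.
have : ae_primitive (fun x => f x * g x) (fun x => p x * g x + f x * q x).
  split; [exact: abs_cont01M|exact: L1_01D|].
  by apply: ae01S2 fp' gq' => x x01; apply: has_deriv01M; lra.
by move=> /FTC01; rewrite int01D// => <-; rewrite addrC addKr.
Qed.

(** The integral of |h| over a union of intervals is small with the length of
    the union. *)
Lemma integral_abs_cont01 (h : R -> R) : leb.-integrable [set: R] (EFin \o h) ->
  abs_cont01 (fun x => \int[leb]_(t in `[0, x]) h t).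
Proof.
move=> ih e e0; have [d [d0 hd]] := integral_normr_continuous ih e0.
exists d => // n a b ab tr len.
have ihA (A : set R) : measurable A -> leb.-integrable A (EFin \o h).
  by move=> mA; apply: integrableS ih.
have nihA (A : set R) : measurable A -> leb.-integrable A (EFin \o (Num.norm \o h)).
  by move=> mA; apply: integrable_norm; exact: ihA.
have mI i : measurable (`]a i, b i[%classic : set R) by exact: measurable_itv.
have mU : measurable (\big[setU/set0]_(i < n) `]a i, b i[%classic : set R).
  by apply: bigsetU_measurable => i _; exact: mI.
apply: le_lt_trans (hd (\big[setU/set0]_(i < n) `]a i, b i[%classic) _ _).
- rewrite -lee_fin /Rintegral fineK; last first.
    by apply: integrable_fin_num; [exact: mU|exact: nihA].
  rewrite ge0_integral_bigsetU//; last 3 first.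
  - exact: index_enum_uniq.
  - exact: sub_trivIset tr.
  - apply/measurable_EFinP/measurableT_comp => //.
    by apply/measurable_EFinP; apply: measurable_int (ihA _ mU).
  rewrite -sumEFin; apply: lee_sum => i _.
  have [a0 abi b1] := ab i.
  have -> : \int[leb]_(t in `[0, b i]) h t - \int[leb]_(t in `[0, a i]) h t =
      \int[leb]_(t in `]a i, b i]) h t.
    apply: Rintegral_itvB; rewrite ?bnd_simp//.
    by apply: ihA; exact: measurable_itv.
  rewrite -Rintegral_itv_bndo_bndc; last exact: ihA.
  apply: le_trans (_ : (\int[leb]_(t in `]a i, b i[) `|h t|)%R%:E <= _)%E.
    by rewrite lee_fin; apply: le_normr_Rintegral => //; exact: ihA.
  by rewrite /Rintegral fineK//; apply: integrable_fin_num => //; exact: nihA.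
- exact: mU.
- rewrite measure_semi_additive_ord//.
  apply: le_lt_trans (_ : ((\sum_(i < n) (b i - a i))%:E < d%:E)%E); last first.
    by rewrite lte_fin.
  rewrite -sumEFin; apply: lee_sum => i _; rewrite [leLHS]lebesgue_measure_itv /=.
  have [_ abi _] := ab i; rewrite lte_fin; case: ifP => _ //.
  by rewrite lee_fin subr_ge0.
Qed.

Lemma ex_ae_primitive h : L1_01 h ->
  exists2 F, ae_primitive F h & F 0 = 0.
Proof.
move=> Ih; pose h0 := h \_ `]0, 1[.
have ih0 : leb.-integrable [set: R] (EFin \o h0).
  rewrite /h0 -restrict_EFin; apply/integrable_restrict => //=.
  by rewrite setTI.
exists (fun x => \int[leb]_(t in `[0, x]) h0 t); last first.
  by rewrite set_itv1 Rintegral_set1.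
split=> //; first exact: integral_abs_cont01.
apply: ae01S (integral_ae_deriv01 ih0) => x x01; rewrite {2}/h0 patchE mem_set//=.
Qed.

Lemma clamp01_continuous p : {within `[0, 1], continuous p} ->
  continuous (p \o (@clamp01 R)).
Proof.
move=> /continuous01P cp x; apply/cvgrPdist_le => e e0.
have /cvgrPdist_le/(_ _ e0)[d /= d0 H] := cp _ (clamp01P x).
exists d => //= y xy; apply: H; last by rewrite /= in_itv /= clamp01P.
have {}xy : `|x - y| < d by [].
apply: le_lt_trans xy => /=.
wlog xley : x y / x <= y.
  move=> W; have [|/ltW] := leP x y; first exact: W.
  by rewrite distrC [`|x - y|]distrC; exact: W.
rewrite distrC [`|x - y|]distrC !ger0_norm ?subr_ge0//; first exact: clamp01_lip.
exact: le_clamp01.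
Qed.

Lemma ex_primitive p : {within `[0, 1], continuous p} ->
  exists2 F, (forall x, 0 <= x <= 1 -> has_deriv01 F x (p x)) & F 0 = 0.
Proof.
move=> /clamp01_continuous cp; set P := p \o _ in cp.
(* integrating from -1 makes 0 an interior point *)
pose F x := \int[leb]_(t in `[-1, x]) P t.
exists (fun x => F x + - F 0); last by rewrite subrr.
move=> x x01; rewrite -[p x]addr0; apply: has_deriv01D => //; last first.
  exact: has_deriv01_cst.
have -> : p x = P x by rewrite /P /= clamp01_id.
have [|||d1 d2] := @continuous_FTC1_closed _ P (-1) x 2 _ _ _ (cp x).
- lra.
- apply: continuous_compact_integrable; first exact: segment_compact.
  exact: continuous_subspaceT.
- lra.
apply: is_derive_has_deriv01; apply: DeriveDef; first exact: d1.
by rewrite -derive1E; exact: d2.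
Qed.

End primitives.

(** * Sign changes of successive derivatives *)

Section sign_changes.
Context {R : realType}.
Implicit Types (f g : R -> R) (a b c p q s x y : R) (l : seq R) (F : nat -> R -> R).

(** Sign changes are counted by points where [f] takes nonzero values of
    alternate signs, the first one with the sign of [s].  Such points are what
    the mean value theorem produces, and they make sense for functions that
    vanish on whole intervals, unlike a number of zeros. *)
Fixpoint alternates s f a b l : Prop :=
  if l is p :: l' then [/\ a < p, 0 < s * f p & alternates (- s) f p b l']
  else a < b.

Lemma alternates_lt s f a b l : alternates s f a b l -> a < b.
Proof. by elim: l s a => //= p l IH s a [ap _ /IH]; exact: lt_trans. Qed.

Lemma alternates_le s f a a' b l : a' <= a ->
  alternates s f a b l -> alternates s f a' b l.
Proof.
by case: l => [|p l] /= aa'; [exact: le_lt_trans|case=> /(le_lt_trans aa')].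
Qed.

Definition is_tower n F : Prop := forall i, (i < n)%N ->
  forall x, 0 <= x <= 1 -> has_deriv01 (F i) x (F i.+1 x).

Section one_derivative.
Variables (f f' : R -> R).
Hypothesis ff' : forall x, 0 <= x <= 1 -> has_deriv01 f x (f' x).

Lemma mean_value_sign s a b : 0 <= a -> a < b -> b <= 1 ->
  0 < s * (f b - f a) -> exists2 c, a < c < b & 0 < s * f' c.
Proof.
move=> a0 ab b1; have [c cab ->] := MVT01 a0 ab b1 ff'.
by rewrite mulrA pmulr_lgt0 ?subr_gt0// => ?; exists c.
Qed.

(* A zero of [f] at the right end counts as one more change; the sign at [p],
   which is not in the list, gives the first one. *)
Lemma alternates_deriv_from (zr : bool) s p b l : 0 <= p -> b <= 1 ->
  (zr -> f b = 0) -> 0 < s * f p -> alternates (- s) f p b l ->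
  exists2 l', size l' = (size l + zr)%N & alternates (- s) f' p b l'.
Proof.
move=> + b1 fb; elim: l s p => [|p2 l IH] s p p0 sp.
  case: zr fb => /= [/(_ isT) fb pb|_]; last by exists [::].
  have [|q /andP[pq qb] fq] := @mean_value_sign (- s) p b p0 pb b1.
    by rewrite fb sub0r mulrNN.
  by exists [:: q].
move=> [pp2 sp2 al].
have p2b := alternates_lt al.
have [|l' sl' al'] := IH (- s) p2 _ sp2 al; first lra.
have [||q /andP[pq qp2] fq] := @mean_value_sign (- s) p p2 p0 pp2; first lra.
  by rewrite mulrBr; nra.
exists (q :: l'); first by rewrite /= sl' addSn.
by split=> //; apply: alternates_le al'; exact: ltW.
Qed.

(** Rolle's theorem for sign changes: between two points of opposite sign
    the derivative has a definite sign, and a zero of [f] at an end of the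
    interval provides one more such point. *)
Lemma alternates_deriv (zl zr : bool) s a b l : 0 <= a -> b <= 1 ->
  (zl -> f a = 0) -> (zr -> f b = 0) -> (0 < size l)%N ->
  alternates s f a b l ->
  exists2 l', size l' = ((size l + zl + zr).-1)%N &
    alternates (if zl then s else - s) f' a b l'.
Proof.
case: l => // p l a0 b1 fa fb _ [ap sp al].
have [|l' sl' al'] := alternates_deriv_from _ b1 fb sp al; first lra.
case: zl fa => [/(_ isT) fa|_]; last first.
  by exists l'; [rewrite sl' addn0|apply: alternates_le al'; exact: ltW].
have pb := alternates_lt al.
have [||q /andP[aq qp] fq] := @mean_value_sign s a p a0 ap; first lra.
  by rewrite fa subr0.
exists (q :: l'); first by rewrite /= sl' addn1 addSn.
by split=> //; apply: alternates_le al'; exact: ltW.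
Qed.

(* One-sided quotients suffice, so this includes the ends [a] and [b]. *)
Lemma deriv01_eq0 a b : 0 <= a -> a < b -> b <= 1 ->
  (forall x, a <= x <= b -> f x = 0) -> forall x, a <= x <= b -> f' x = 0.
Proof.
move=> a0 ab b1 f0 x xab; apply/eqP; rewrite -normr_eq0 eq_le normr_ge0 andbT.
apply/ler_addgt0Pr => e e0; rewrite add0r.
have x01 : 0 <= x <= 1 by lra.
have /has_deriv01P/(_ _ e0)[d d0 H] := ff' x01.
have [y yab [yx yd]] : exists2 y, a <= y <= b & y != x /\ `|y - x| < d.
  have [xm|mx] := leP x ((a + b) / 2).
  - exists (x + Num.min (d / 2) ((b - a) / 2)).
      by rewrite /Num.min; case: ifP; lra.
    have m0 : 0 < Num.min (d / 2) ((b - a) / 2) by rewrite lt_min; lra.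
    have md : Num.min (d / 2) ((b - a) / 2) <= d / 2 by rewrite ge_min lexx.
    split; first by apply/eqP; lra.
    by rewrite addrC addKr gtr0_norm//; lra.
  - exists (x - Num.min (d / 2) ((b - a) / 2)).
      by rewrite /Num.min; case: ifP; lra.
    have m0 : 0 < Num.min (d / 2) ((b - a) / 2) by rewrite lt_min; lra.
    have md : Num.min (d / 2) ((b - a) / 2) <= d / 2 by rewrite ge_min lexx.
    split; first by apply/eqP; lra.
    by rewrite addrAC subrr sub0r normrN gtr0_norm//; lra.
have := H y; rewrite !f0// subrr sub0r normrN normrM => /(_ _ yd) h.
have y01 : 0 <= y <= 1 by lra.
by move: (h y01); rewrite ler_pM2r// normr_gt0 subr_eq0.
Qed.

End one_derivative.

Lemma tower_eq0 n F a b : 0 <= a -> a < b -> b <= 1 -> is_tower n F ->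
  (forall x, a <= x <= b -> F 0%N x = 0) ->
  forall i, (i <= n)%N -> forall x, a <= x <= b -> F i x = 0.
Proof.
move=> a0 ab b1 tF F0; elim=> // i IH ni.
by apply: (deriv01_eq0 (tF i ni)) => //; apply: IH; exact: ltnW.
Qed.

(** Each derivation loses one point and gains one for each end at which the
    function vanishes. *)
Lemma alternates_tower (zl zr : bool) n F s a b l : 0 <= a -> b <= 1 ->
  is_tower n F ->
  (zl -> forall i, (i < n)%N -> F i a = 0) ->
  (zr -> forall i, (i < n)%N -> F i b = 0) ->
  (0 < size l)%N -> (n <= size l + n * (zl + zr))%N ->
  alternates s (F 0%N) a b l ->
  exists2 l', size l' = (size l + n * (zl + zr) - n)%N &
    alternates ((if zl then 1 else -1) ^+ n * s) (F n) a b l'.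
Proof.
move=> a0 b1; elim: n => [|n IH] tF Fa Fb l0 nl al.
  by exists l; [rewrite mul0n addn0 subn0|rewrite expr0 mul1r].
have [||||||l' sl' al'] := IH => //.
- by move=> i ni; apply: tF; exact: ltnW.
- by move=> z i ni; apply: Fa => //; exact: ltnW.
- by move=> z i ni; apply: Fb => //; exact: ltnW.
- by move: nl l0; case: (zl); case: (zr) => /=; lia.
have [|||l'' sl'' al''] :=
  @alternates_deriv _ _ (tF n (ltnSn n)) zl zr _ a b l' a0 b1 _ _ _ al'.
- by move=> z; apply: Fa.
- by move=> z; apply: Fb.
- by move: l0 nl sl'; case: (zl); case: (zr) => /=; lia.
exists l''.
  by move: l0 nl sl' sl''; case: (zl); case: (zr) => /=; lia.
move: al''; case: zl {IH Fa nl al' sl' sl''} => /=; first by rewrite !expr1n.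
by rewrite exprS mulN1r mulNr.
Qed.

End sign_changes.

(** * Positivity for the Dirichlet conditions *)

Section positivity.
Context {R : realType}.
Implicit Types (a b c s x y : R) (l : seq R) (F : nat -> R -> R).

(** The first [n] derivations gain a point, as the function vanishes at both
    ends; the next [m] lose one, unless all derivatives vanish at an end. *)
Lemma alternates_two_phases (zl zr : bool) n m F s a b l :
  0 <= a -> b <= 1 -> is_tower (m + n) F ->
  (forall i, (i < n)%N -> F i a = 0 /\ F i b = 0) ->
  (zl -> forall i, (i < m + n)%N -> F i a = 0) ->
  (zr -> forall i, (i < m + n)%N -> F i b = 0) ->
  (0 < size l)%N -> (m <= size l + n)%N ->
  alternates s (F 0%N) a b l ->
  exists2 l', size l' = (size l + n + m * (zl + zr) - m)%N &
    alternates ((if zl then 1 else -1) ^+ m * s) (F (m + n)%N) a b l'.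
Proof.
move=> a0 b1 tF F0 Fa Fb l0 ml al.
have [||||l1 sl1 al1] :=
  @alternates_tower _ true true n F s a b l a0 b1 _ _ _ l0 _ al.
- by move=> i ni; apply: tF; rewrite ltn_addl.
- by move=> _ i /F0[].
- by move=> _ i /F0[].
- by rewrite /=; lia.
rewrite expr1n mul1r in al1.
have [|||||l2 sl2 al2] := @alternates_tower _ zl zr m (fun i => F (i + n)%N)
  s a b l1 a0 b1 _ _ _ _ _ al1.
- by move=> i im x x01; apply: tF => //; rewrite ltn_add2r.
- by move=> z i im; apply: Fa => //; rewrite ltn_add2r.
- by move=> z i im; apply: Fb => //; rewrite ltn_add2r.
- by rewrite sl1 /=; lia.
- by rewrite sl1 /=; case: (zl); case: (zr) => /=; lia.
by exists l2 => //; rewrite sl2 sl1 /=; case: (zl); case: (zr) => /=; lia.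
Qed.

Variables (m : nat) (F : nat -> R -> R).
Hypothesis tF : is_tower (m + m).+1 F.
Hypothesis F01 : forall i, (i <= m)%N -> F i 0 = 0 /\ F i 1 = 0.
Hypothesis Fnd : forall x y, 0 <= x -> x <= y -> y <= 1 ->
  (-1) ^+ m.+1 * F (m + m).+1 x <= (-1) ^+ m.+1 * F (m + m).+1 y.

(** A negative value is one sign for [F 0], hence [m.+2] signs for [F m.+1] and
    two for [F (m + m).+1]; they are in the wrong order for a nondecreasing
    function. *)
Lemma dirichlet_tower_ge0 x : 0 <= x <= 1 -> 0 <= F 0%N x.
Proof.
move=> x01; rewrite leNgt; apply/negP => Fx.
have [F00 F10] := F01 (leq0n m).
have x0 : 0 < x.
  by rewrite lt_neqAle; apply/andP; split; [apply/eqP => x0; move: Fx; rewrite -x0 F00 ltxx|lra].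
have x1 : x < 1.
  by rewrite lt_neqAle; apply/andP; split; [apply/eqP => x1; move: Fx; rewrite x1 F10 ltxx|lra].
have [||||||l sl al] := @alternates_two_phases false false m.+1 m F (-1) 0 1 [:: x]
  (lexx 0) (lexx 1) _ _ _ _ isT.
- by rewrite addnS.
- by move=> i; rewrite ltnS; exact: F01.
- by [].
- by [].
- by rewrite /=; lia.
- by rewrite /= mulN1r oppr_gt0.
case: l sl al => [|p [|q l]] /= sl al; [by move: sl; clear; lia|by move: sl; clear; lia|].
case: al => p0 Fp [pq Fq al].
have q1 := alternates_lt al.
have := @Fnd p q (ltW p0) (ltW pq) (ltW q1).
move: Fp Fq; rewrite addnS exprS; set e := (-1) ^+ m; lra.
Qed.

(* A monotone function that vanishes at an end of the interval has a constant
   sign there. *)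
Let last_sign_constant a b s p q l : 0 <= a -> b <= 1 ->
  F (m + m).+1 a = 0 \/ F (m + m).+1 b = 0 ->
  ~ alternates s (F (m + m).+1) a b [:: p, q & l].
Proof.
move=> a0 b1 F0 [ap Fp [pq Fq al]]; have qb := alternates_lt al.
have pq' := @Fnd p q (ltW (le_lt_trans a0 ap)) (ltW pq) (ltW (lt_le_trans qb b1)).
have := @Fnd a p a0 (ltW ap) (ltW (lt_le_trans (lt_trans pq qb) b1)).
have := @Fnd q b (ltW (le_lt_trans a0 (lt_trans ap pq))) (ltW qb) b1.
have e0 : (-1) ^+ m.+1 = 1 :> R \/ (-1) ^+ m.+1 = -1 :> R.
  by rewrite -signr_odd; case: odd; [right|left].
have AB : F (m + m).+1 p * F (m + m).+1 q < 0.
  rewrite ltNge; apply/negP => AB; have := mulr_gt0 Fp Fq.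
  rewrite ltNge => /negP; apply.
  rewrite mulNr mulrN oppr_le0 mulrACA mulr_ge0//.
  by rewrite -expr2 sqr_ge0.
move: AB pq'; set A := F _ p; set B := F _ q => AB.
move: AB; case: F0 => ->; case: e0 => -> AB;
  rewrite ?mul1r ?mulN1r ?oppr0 ?lerN2 => *; nra.
Qed.

(** The zero [c] is a minimum.  If the function is positive on both sides of it,
    the last derivative has four signs, too many for a monotone function.
    Otherwise the function vanishes on one side of [c], so all its derivatives
    vanish at [c]: on the other side no derivation loses a sign, and the last
    derivative keeps two of them. *)
Lemma dirichlet_tower_eq0 c : 0 < c < 1 -> F 0%N c = 0 ->
  forall x, 0 <= x <= 1 -> F 0%N x = 0.
Proof.
move=> c01 Fc x x01; have [c0 c1] := andP c01.
have [->//|] := eqVneq (F 0%N x) 0.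
rewrite neq_lt ltNge dirichlet_tower_ge0//= => Fx.
have xc : x != c by apply/eqP => xc; move: Fx; rewrite xc Fc ltxx.
have [F00 F10] := F01 (leq0n m).
have [F0|] := pselect (forall y, 0 <= y <= c -> F 0%N y = 0).
  have cx : c < x.
    rewrite ltNge; apply/negP => xlec; move: Fx; by rewrite F0 ?ltxx//; have /andP[-> _] := x01.
  have Fc0 i : (i <= (m + m).+1)%N -> F i c = 0.
    by move=> im; apply: (tower_eq0 (lexx 0) c0 (ltW c1) tF F0 im); rewrite lexx ltW.
  have [||||||l sl al] := @alternates_two_phases true false m.+1 m F 1 c 1 [:: x]
    (ltW c0) (lexx 1) _ _ _ _ isT.
  - by rewrite addnS.
  - by move=> i im; split; [apply: Fc0; move: im; clear; lia|case: (F01 im)].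
  - by move=> _ i im; apply: Fc0; move: im; clear; lia.
  - by [].
  - by clear; rewrite /=; lia.
  - rewrite /= mul1r; split; [exact: cx|exact: Fx|].
    rewrite lt_neqAle; apply/andP; split; last by case/andP: x01.
    by apply/eqP => x1; move: Fx; rewrite x1 F10 ltxx.
  case: l sl al => [|p [|q l]] /= sl al; [by move: sl; clear; lia|by move: sl; clear; lia|].
  exfalso; rewrite addnS in al.
  by apply: (@last_sign_constant c 1 _ p q l _ _ _ al); [lra|lra|left; exact: Fc0].
move=> /existsNP[y /not_implyP[y01 /eqP]].
rewrite neq_lt ltNge dirichlet_tower_ge0/=; last lra.
move=> Fy.
have yc : y < c.
  rewrite lt_neqAle; apply/andP; split; last lra.
  by apply/eqP => eyc; move: Fy; rewrite eyc Fc ltxx.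
have y0 : 0 < y.
  rewrite lt_neqAle; apply/andP; split; last lra.
  by apply/eqP => y0; move: Fy; rewrite -y0 F00 ltxx.
have [F0|] := pselect (forall z, c <= z <= 1 -> F 0%N z = 0).
  have Fc0 i : (i <= (m + m).+1)%N -> F i c = 0.
    by move=> im; apply: (tower_eq0 (ltW c0) c1 (lexx 1) tF F0 im); rewrite lexx ltW.
  have [||||||l sl al] := @alternates_two_phases false true m.+1 m F 1 0 c [:: y]
    (lexx 0) (ltW c1) _ _ _ _ isT.
  - by rewrite addnS.
  - by move=> i im; split; [case: (F01 im)|apply: Fc0; move: im; clear; lia].
  - by [].
  - by move=> _ i im; apply: Fc0; move: im; clear; lia.
  - by clear; rewrite /=; lia.
  - by rewrite /= mul1r.
  case: l sl al => [|p [|q l]] /= sl al; [by move: sl; clear; lia|by move: sl; clear; lia|].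
  exfalso; rewrite addnS in al.
  by apply: (@last_sign_constant 0 c _ p q l _ _ _ al); [lra|lra|right; exact: Fc0].
move=> /existsNP[z /not_implyP[z01 /eqP]].
rewrite neq_lt ltNge dirichlet_tower_ge0/=; last lra.
move=> Fz.
have cz : c < z.
  rewrite lt_neqAle; apply/andP; split; last lra.
  by apply/eqP => ezc; move: Fz; rewrite -ezc Fc ltxx.
have z1 : z < 1.
  rewrite lt_neqAle; apply/andP; split; last lra.
  by apply/eqP => z1; move: Fz; rewrite z1 F10 ltxx.
exfalso.
(* [F 0] rises after 0, falls before c, rises after c and falls before 1 *)
have dF := tF (ltn0Sn _).
have [|q1 /andP[q1a q1b] Fq1] := mean_value_sign dF (lexx 0) y0 (ltW (lt_trans yc c1)) (s := 1).
  by rewrite F00; lra.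
have [|q2 /andP[q2a q2b] Fq2] := mean_value_sign dF (ltW y0) yc (ltW c1) (s := -1).
  by rewrite Fc; lra.
have [|q3 /andP[q3a q3b] Fq3] := mean_value_sign dF (ltW c0) cz (ltW z1) (s := 1).
  by rewrite Fc; lra.
have [|q4 /andP[q4a q4b] Fq4] := mean_value_sign dF (ltW (lt_trans c0 cz)) z1 (lexx 1) (s := -1).
  by rewrite F10; lra.
have [||||||l sl al] := @alternates_two_phases false false m m (fun i => F i.+1) 1 0 1
  [:: q1; q2; q3; q4] (lexx 0) (lexx 1) _ _ _ _ isT.
- by move=> i im; apply: tF; move: im; clear; lia.
- by move=> i im; apply: F01.
- by [].
- by [].
- by clear; rewrite /=; lia.
- by move: q1a q1b q2a q2b q3a q3b q4a q4b Fq1 Fq2 Fq3 Fq4; clear; rewrite /= opprK;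
  do !split; lra.
case: l sl al => [|p1 [|p2 [|p3 l]]] /= sl al;
  [by move: sl; clear; lia|by move: sl; clear; lia|by move: sl; clear; lia|].
case: al => p10 Fp1 [p12 Fp2 [p23 Fp3 al]]; have p31 := alternates_lt al.
have := @Fnd p1 p2 (ltW p10) (ltW p12) (ltW (lt_trans p23 p31)).
have := @Fnd p2 p3 (ltW (lt_trans p10 p12)) (ltW p23) (ltW p31).
have e0 : (-1) ^+ m = 1 :> R \/ (-1) ^+ m = -1 :> R.
  by rewrite -signr_odd; case: odd; [right|left].
move: Fp1 Fp2 Fp3; rewrite exprS; case: e0 => ->; clear; lra.
Qed.

End positivity.

(** * The Dirichlet problem *)

Section towers.
Context {R : realType}.
Implicit Types (f g h p q u v : R -> R) (x y c : R) (F G : nat -> R -> R).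

Lemma nderiv01_tower n F : is_tower n F ->
  forall i, (i <= n)%N -> forall x, 0 <= x <= 1 -> nderiv01 i (F 0%N) x = F i x.
Proof.
move=> tF; elim=> // i IH ni x x01.
rewrite -(has_deriv01E x01 (tF i ni x x01)) /nderiv01 iterS.
by apply: deriv01_eq => // y y01; apply: IH => //; exact: ltnW.
Qed.

Lemma tower_continuous n F : is_tower n F -> {within `[0, 1], continuous F n} ->
  forall i, (i <= n)%N -> {within `[0, 1], continuous F i}.
Proof.
move=> tF cF i; rewrite leq_eqVlt => /predU1P[->//|ni].
exact: has_deriv01_continuous (tF i ni).
Qed.

Lemma tower_Cn01 n F : is_tower n F -> {within `[0, 1], continuous F n} ->
  Cn01 n (F 0%N).
Proof.
move=> tF cF; split=> [i ni x x01|].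
  apply: (@has_deriv01_derivable _ _ _ (F i.+1 x)).
  apply: has_deriv01_eq (tF i ni x x01) => // y y01.
  by rewrite (nderiv01_tower tF)// ltnW.
by apply: continuous01_eq cF => x x01; rewrite (nderiv01_tower tF).
Qed.

Lemma Cn01_tower n u : Cn01 n u -> is_tower n (fun i => nderiv01 i u).
Proof. by move=> [du _] i ni x x01; exact: derivable01_has (du i ni x x01). Qed.

Lemma Cn01_continuous n u : Cn01 n u ->
  forall i, (i <= n)%N -> {within `[0, 1], continuous (nderiv01 i u)}.
Proof. by move=> Cu; have [_ cu] := Cu; exact: tower_continuous (Cn01_tower Cu) cu. Qed.

Lemma nderiv01_eq u v : (forall x, 0 <= x <= 1 -> u x = v x) ->
  forall n x, 0 <= x <= 1 -> nderiv01 n u x = nderiv01 n v x.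
Proof.
move=> uv; elim=> [//|n IH] x x01; rewrite /nderiv01 !iterS.
by apply: deriv01_eq => // y y01; exact: IH.
Qed.

Lemma towerD n F G : is_tower n F -> is_tower n G ->
  is_tower n (fun i x => F i x + G i x).
Proof. by move=> tF tG i ni x x01; apply: has_deriv01D => //; [exact: tF|exact: tG]. Qed.

Lemma towerZ c n F : is_tower n F -> is_tower n (fun i x => c * F i x).
Proof. by move=> tF i ni x x01; apply: has_deriv01Z => //; exact: tF. Qed.

Lemma Cn01D n u v : Cn01 n u -> Cn01 n v ->
  Cn01 n (fun x => u x + v x) /\
  forall i, (i <= n)%N -> forall x, 0 <= x <= 1 ->
    nderiv01 i (fun x => u x + v x) x = nderiv01 i u x + nderiv01 i v x.
Proof.
move=> Cu Cv; have tuv := towerD (Cn01_tower Cu) (Cn01_tower Cv).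
split; last by move=> i ni x x01; rewrite -(nderiv01_tower tuv ni x01).
apply: (tower_Cn01 tuv).
by move=> x; apply: continuousD; [case: Cu => _|case: Cv => _]; apply.
Qed.

Lemma Cn01Z c n u : Cn01 n u ->
  Cn01 n (fun x => c * u x) /\
  forall i, (i <= n)%N -> forall x, 0 <= x <= 1 ->
    nderiv01 i (fun x => c * u x) x = c * nderiv01 i u x.
Proof.
move=> Cu; have tu := @towerZ c _ _ (Cn01_tower Cu).
split; last by move=> i ni x x01; rewrite -(nderiv01_tower tu ni x01).
apply: (tower_Cn01 tu).
by move=> x; apply: continuousM; [exact: cst_continuous|case: Cu => _; apply].
Qed.

Lemma ex_tower n p : {within `[0, 1], continuous p} ->
  exists F, [/\ is_tower n F, F n = p & forall i, (i < n)%N -> F i 0 = 0].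
Proof.
elim: n p => [|n IH] p cp; first by exists (fun=> p).
have [P Pp P0] := ex_primitive cp.
have [G [tG Gn G0]] := IH P (has_deriv01_continuous Pp).
exists (fun i => if i == n.+1 then p else G i); split.
- move=> i; rewrite ltnS leq_eqVlt => /predU1P[->|ni] x x01.
    by rewrite eqxx ltn_eqF// Gn; exact: Pp.
  by rewrite eqSS (ltn_eqF ni) (ltn_eqF (leqW ni)); exact: tG.
- by rewrite eqxx.
- move=> i ni; rewrite ltn_eqF//; move: ni; rewrite ltnS leq_eqVlt.
  by move=> /predU1P[->|/G0//]; rewrite Gn.
Qed.

Lemma has_deriv01_poly (r : {poly R}) x : 0 <= x <= 1 ->
  has_deriv01 (horner r) x (r^`()).[x].
Proof.
move=> x01; elim/poly_ind: r => [|r c IH].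
  rewrite deriv0 horner0; apply: has_deriv01_eq (has_deriv01_cst 0 x) => // y _.
  by rewrite horner0.
rewrite derivMXaddC !hornerE.
have := has_deriv01D x01 (has_deriv01M x01 IH (has_deriv01_id x)) (has_deriv01_cst c x).
rewrite mulr1 addr0 addrC; apply: has_deriv01_eq => // y _.
by rewrite !hornerE.
Qed.

Lemma poly_tower n (r : {poly R}) : is_tower n (fun i => horner r^`(i)).
Proof. by move=> i _ x x01; rewrite derivnS; exact: has_deriv01_poly. Qed.

Lemma derivn_root_order (c : R) n (r : {poly R}) j : (j <= n)%N ->
  ((('X - c%:P) ^+ n * r)^`(j)).[c] = if j == n then n`!%:R * r.[c] else 0.
Proof.
elim: n r j => [|n IH] r j; first by rewrite leqn0 => /eqP ->; rewrite expr0 !mul1r.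
case: j => [_|j]; first by rewrite derivn0 hornerM horner_exp hornerXsubC subrr expr0n mul0r.
rewrite ltnS eqSS => jn; rewrite derivSn.
have -> : (('X - c%:P) ^+ n.+1 * r)^`() =
    ('X - c%:P) ^+ n * (n.+1%:R *: r + ('X - c%:P) * r^`()).
  rewrite derivM deriv_exp derivXsubC mul1r /= exprS.
  by rewrite scaler_nat; ring.
rewrite IH//; case: eqP => // _; rewrite factS natrM !hornerE.
by rewrite subrr mul0r addr0; ring.
Qed.

(** The derivatives at 1 are adjusted one order at a time: adding a multiple of
    X^k (X - 1)^n changes neither the orders below [n] at 1 nor the orders
    below [k] at 0. *)
Lemma ex_hermite k n (b : nat -> R) : exists2 r : {poly R},
  (size r <= k + n)%N &
  (forall j, (j < k)%N -> (r^`(j)).[0] = 0) /\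
  (forall j, (j < n)%N -> (r^`(j)).[1] = b j).
Proof.
elim: n => [|n [r sr [r0 r1]]].
  by exists 0; rewrite ?size_poly0//; split=> // j _; rewrite derivn_poly0 ?size_poly0// horner0.
pose c := (b n - (r^`(n)).[1]) / n`!%:R.
pose t := ('X - 1%:P) ^+ n * 'X^k : {poly R}.
have st : (size t <= k + n.+1)%N.
  rewrite /t (leq_trans (size_polyMleq _ _))// size_exp_XsubC size_polyXn.
  by rewrite /=; lia.
exists (r + c *: t).
  rewrite (leq_trans (size_polyD _ _))// geq_max; apply/andP; split.
    by rewrite (leq_trans sr)// leq_add2l.
  by rewrite (leq_trans (size_scale_leq _ _)).
split=> j jn; rewrite derivnD derivnZ hornerD hornerZ.
  have tE : t = ('X - 0%:P) ^+ k * ('X - 1%:P) ^+ n.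
    by rewrite polyC0 subr0 mulrC.
  by rewrite r0// tE derivn_root_order ?(ltnW jn)// (ltn_eqF jn) mulr0 addr0.
move: jn; rewrite ltnS leq_eqVlt => /predU1P[->|jn].
  rewrite /t derivn_root_order// eqxx hornerXn expr1n mulr1 /c divfK.
    by rewrite addrC subrK.
  by rewrite pnatr_eq0 -lt0n fact_gt0.
by rewrite /t derivn_root_order ?(ltnW jn)// (ltn_eqF jn) mulr0 addr0 r1.
Qed.

End towers.

Section dirichlet.
Context {R : realType}.
Implicit Types (f g h p q u v y : R -> R) (x c : R) (k : nat).
Notation leb := (@lebesgue_measure R).

(** The problem (-1)^k y^(2k) = h with the Dirichlet conditions.  Since y^(2k)
    exists only almost everywhere, the equation is put on the derivative of
    order 2k - 1, of which (-1)^k h is the density. *)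
Definition dirichlet_solution k h y : Prop :=
  [/\ Cn01 (2 * k).-1 y,
      ae_primitive (nderiv01 (2 * k).-1 y) (fun x => (-1) ^+ k * h x) &
      boundary_conditions k y].

Lemma ae_primitive_congr f g p q : (forall x, 0 <= x <= 1 -> f x = g x) ->
  (forall x, 0 < x < 1 -> p x = q x) -> ae_primitive f p -> ae_primitive g q.
Proof.
move=> fg pq [cf Ip fp]; split.
- exact: abs_cont01_eq cf.
- exact: L1_01_eq Ip.
- apply: ae01S fp => x x01; rewrite pq// => fx.
  by apply: has_deriv01_eq fx => //; lra.
Qed.

Lemma dirichlet_solutionD k h1 h2 y1 y2 :
  dirichlet_solution k h1 y1 -> dirichlet_solution k h2 y2 ->
  dirichlet_solution k (fun x => h1 x + h2 x) (fun x => y1 x + y2 x).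
Proof.
move=> [C1 P1 B1] [C2 P2 B2]; have [C12 E12] := Cn01D C1 C2; split=> //.
- apply: ae_primitive_congr (ae_primitiveD P1 P2) => x x01.
    by rewrite E12.
  by rewrite mulrDr.
- move=> j jk; have [B10 B11] := B1 j jk; have [B20 B21] := B2 j jk.
  have jk2 : (j <= (2 * k).-1)%N by lia.
  by rewrite !E12 ?lexx ?ler01// B10 B11 B20 B21 addr0.
Qed.

Lemma dirichlet_solutionZ c k h y : dirichlet_solution k h y ->
  dirichlet_solution k (fun x => c * h x) (fun x => c * y x).
Proof.
move=> [C P B]; have [Cc Ec] := Cn01Z c C; split=> //.
- apply: ae_primitive_congr (ae_primitiveZ c P) => x x01.
    by rewrite Ec.
  by rewrite mulrCA.
- move=> j jk; have [B0 B1] := B j jk.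
  have jk2 : (j <= (2 * k).-1)%N by lia.
  by rewrite !Ec ?lexx ?ler01// B0 B1 mulr0.
Qed.

Lemma dirichlet_solutionB k h1 h2 y1 y2 :
  dirichlet_solution k h1 y1 -> dirichlet_solution k h2 y2 ->
  dirichlet_solution k (fun x => h1 x - h2 x) (fun x => y1 x - y2 x).
Proof.
move=> S1 /(dirichlet_solutionZ (-1)) /(dirichlet_solutionD S1).
by congr dirichlet_solution; apply/funext => x; rewrite mulN1r.
Qed.

Lemma ae_primitive_nondecreasing f p : ae_primitive f p ->
  ae01 (fun x => 0 <= p x) ->
  forall x x', 0 <= x -> x <= x' -> x' <= 1 -> f x <= f x'.
Proof.
move=> fp p0 x x' x0 xx x1; have [_ Ip _] := fp.
have Ia : L1_01 (fun t => `|p t|) by exact: integrable_norm.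
have pa : ae01 (fun t => p t = `|p t|) by apply: ae01S p0 => t _ /ger0_norm.
have sub (z t : R) : z <= 1 -> t \in `]0, z[ -> 0 < t < 1 by rewrite in_itv /=; lra.
have Ei z : z <= 1 ->
    \int[leb]_(t in `]0, z[) p t = \int[leb]_(t in `]0, z[) `|p t|.
  by move=> z1; apply: ae_eq_Rintegral01 => // t; exact: sub.
rewrite (ae_primitive_integral fp (x := x)); last by apply/andP; split; lra.
rewrite (ae_primitive_integral fp (x := x')); last by apply/andP; split; lra.
rewrite lerD2l Ei ?Ei//; last lra.
have fin z : z <= 1 -> (\int[leb]_(t in `]0%R, z[) `|p t|%:E)%E \is a fin_num.
  move=> z1; apply: integrable_fin_num; first exact: measurable_itv.
  by apply: L1_01_integrableS Ia => t; exact: sub.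
rewrite /Rintegral fine_le ?fin//; first by lra.
have Iax : leb.-integrable `]0, x'[%classic (EFin \o (fun t => `|p t|)).
  by apply: L1_01_integrableS Ia => t; exact: sub.
apply: ge0_subset_integral => //; first exact: measurable_int Iax.
by apply: subset_itvl; rewrite bnd_simp.
Qed.

Lemma dirichlet_solution_tower m h y : dirichlet_solution m.+1 h y ->
  ae01 (fun x => 0 <= h x) ->
  [/\ is_tower (m + m).+1 (fun i => nderiv01 i y),
      forall i, (i <= m)%N -> nderiv01 i y 0 = 0 /\ nderiv01 i y 1 = 0,
      ae_primitive (nderiv01 (m + m).+1 y) (fun x => (-1) ^+ m.+1 * h x) &
      forall x z, 0 <= x -> x <= z -> z <= 1 ->
        (-1) ^+ m.+1 * nderiv01 (m + m).+1 y x <=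
        (-1) ^+ m.+1 * nderiv01 (m + m).+1 y z].
Proof.
have -> : dirichlet_solution m.+1 h y = [/\ Cn01 (m + m).+1 y,
      ae_primitive (nderiv01 (m + m).+1 y) (fun x => (-1) ^+ m.+1 * h x) &
      boundary_conditions m.+1 y].
  by rewrite /dirichlet_solution; have -> : (2 * m.+1).-1 = (m + m).+1 by lia.
move=> [C P B] h0; split=> //; first exact: Cn01_tower.
have := ae_primitiveZ ((-1) ^+ m.+1) P.
move=> /ae_primitive_nondecreasing; apply; apply: ae01S h0 => x _.
by rewrite mulrA -expr2 sqrr_sign mul1r.
Qed.

Lemma dirichlet_solution_ge0 k h y : (0 < k)%N -> dirichlet_solution k h y ->
  ae01 (fun x => 0 <= h x) -> forall x, 0 <= x <= 1 -> 0 <= y x.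
Proof.
case: k => // m _ /dirichlet_solution_tower sol /sol[t b _ nd] x.
exact: (dirichlet_tower_ge0 t b nd).
Qed.

(** If the solution vanishes at an interior point, it vanishes identically, and
    so does the right-hand side. *)
Lemma dirichlet_solution_gt0 k h y : (0 < k)%N -> dirichlet_solution k h y ->
  ae01 (fun x => 0 <= h x) -> ~ ae01 (fun x => h x = 0) -> positive01 y.
Proof.
move=> k0 sol h0 hn0 x x01.
have x01' : 0 <= x <= 1 by lra.
rewrite lt_neqAle (dirichlet_solution_ge0 k0 sol h0)// andbT eq_sym.
apply/eqP => yx; apply: hn0; case: k k0 sol => // m _.
move=> /dirichlet_solution_tower /(_ h0)[t b P nd].
have y0 := dirichlet_tower_eq0 t b nd x01 yx.
have [_ _ d] := P; apply: ae01S d => z z01 dz.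
have z01' : 0 <= z <= 1 by lra.
have d0 : has_deriv01 (nderiv01 (m + m).+1 y) z 0.
  apply: has_deriv01_eq (has_deriv01_cst 0 z) => // s s01.
  by rewrite (tower_eq0 (lexx 0) ltr01 (lexx 1) t y0).
have := has_deriv01E z01' d0; rewrite (has_deriv01E z01' dz) => /eqP.
by rewrite mulf_eq0 signr_eq0 => /eqP.
Qed.

(** The difference of two solutions and its opposite are both nonnegative. *)
Lemma dirichlet_solution_unique k h1 h2 y1 y2 : (0 < k)%N ->
  dirichlet_solution k h1 y1 -> dirichlet_solution k h2 y2 ->
  ae01 (fun x => h1 x = h2 x) -> forall x, 0 <= x <= 1 -> y1 x = y2 x.
Proof.
move=> k0 S1 S2 h12 x x01; apply/eqP; rewrite eq_le.
have := dirichlet_solution_ge0 k0 (dirichlet_solutionB S1 S2).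
have := dirichlet_solution_ge0 k0 (dirichlet_solutionB S2 S1).
rewrite -subr_ge0 -[X in _ && X]subr_ge0 => -> //.
  by move=> -> //; apply: ae01S h12 => z _ ->; rewrite subrr.
by apply: ae01S h12 => z _ ->; rewrite subrr.
Qed.

(** Primitives from 0 satisfy the equation and the conditions at 0; a polynomial
    of degree less than 2k, divisible by X^k, restores those at 1. *)
Lemma ex_dirichlet_solution k h : (0 < k)%N -> L1_01 h ->
  exists y, dirichlet_solution k h y.
Proof.
move=> k0 Ih; have [f fh f0] := ex_ae_primitive (L1_01Z ((-1) ^+ k) Ih).
have [F [tF Fn F0]] := ex_tower (2 * k).-1 (ae_primitive_continuous fh).
have [r sr [r0 r1]] := ex_hermite k k (fun j => - F j 1).
have tG := towerD tF (@poly_tower _ (2 * k).-1 r).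
set G := (fun i x => _) in tG.
have cr : {within `[0, 1], continuous (horner r^`((2 * k).-1))}.
  by apply: (has_deriv01_continuous (f' := horner (r^`((2 * k).-1))^`())) => x;
     exact: has_deriv01_poly.
have cG : {within `[0, 1], continuous (G (2 * k).-1)}.
  rewrite /G Fn; have cf := ae_primitive_continuous fh.
  by move=> x; apply: continuousD; [exact: cf|exact: cr].
exists (G 0%N); split.
- exact: tower_Cn01 tG cG.
- apply: (@ae_primitive_congr (G (2 * k).-1) _
      (fun x => (-1) ^+ k * h x + (0 : {poly R}).[x])).
  + by move=> x x01; rewrite (nderiv01_tower tG).
  + by move=> x _; rewrite horner0 addr0.
  rewrite /G Fn; apply: ae_primitiveD => //.
  have -> : (0 : {poly R}) = (r^`((2 * k).-1))^`().
    by rewrite -derivnS derivn_poly0// (leq_trans sr)//; lia.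
  apply: C1_ae_primitive; last by move=> x; exact: has_deriv01_poly.
  by apply: (has_deriv01_continuous (f' := horner ((r^`((2 * k).-1))^`())^`())) => x;
     exact: has_deriv01_poly.
- move=> j jk; have jk2 : (j <= (2 * k).-1)%N by lia.
  rewrite !(nderiv01_tower tG jk2) ?lexx ?ler01// /G r0// r1// addr0 subrr.
  split=> //; move: jk2; rewrite leq_eqVlt => /predU1P[->|/F0//].
  by rewrite Fn.
Qed.

(** Each integration by parts moves one derivation from [g] to [f]; the boundary
    terms vanish with [f]. *)
Lemma int01_shift_derivatives (f g : nat -> R -> R) k n :
  (forall i, (i < k)%N -> ae_primitive (f i) (f i.+1)) ->
  (forall i, (i < k)%N -> f i 0 = 0 /\ f i 1 = 0) ->
  (forall i, (i < n + k)%N -> ae_primitive (g i) (g i.+1)) ->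
  int01 (fun x => f 0%N x * g (n + k)%N x) =
    (-1) ^+ k * int01 (fun x => f k x * g n x).
Proof.
elim: k n => [|k IH] n fp f0 gp; first by rewrite addn0 mul1r.
rewrite addnS -addSn IH.
- have [fk0 fk1] := f0 k (ltnSn k).
  rewrite (int01_by_parts (fp k (ltnSn k)) (gp n _)); last by rewrite addnS ltnS leq_addr.
  by rewrite fk0 fk1 !mul0r subrr sub0r exprS mulN1r mulrN mulNr.
- by move=> i ik; apply: fp; exact: ltnW.
- by move=> i ik; apply: f0; exact: ltnW.
- by move=> i; rewrite addSn -addnS; exact: gp.
Qed.

Lemma abs_cont01_ae_primitive f : abs_cont01 f -> L1_01 (deriv01 f) ->
  ae_primitive f (deriv01 f).
Proof.
move=> cf If; split=> //; have [h ih hE] := abs_cont01_density cf.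
apply: ae01S (integral_ae_deriv01 ih) => x x01 dx; apply: derivable01_has.
have x01' : 0 <= x <= 1 by lra.
apply: (@has_deriv01_derivable _ _ _ (0 + h x)).
apply: (@has_deriv01_eq _ (fun x => f 0 + \int[leb]_(t in `[0, x]) h t)) => //.
  by move=> y y01; rewrite -hE.
by apply: has_deriv01D => //; exact: has_deriv01_cst.
Qed.

Lemma Hk_ae_primitive k v : (0 < k)%N -> Hk k v ->
  forall i, (i < k)%N -> ae_primitive (nderiv01 i v) (nderiv01 i.+1 v).
Proof.
case: k => // m _ [Cv cv /L2_01_L1 Iv] i; rewrite ltnS leq_eqVlt => /predU1P[->|im].
  exact: abs_cont01_ae_primitive.
apply: C1_ae_primitive; last exact: (Cn01_tower Cv).
exact: (Cn01_continuous Cv).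
Qed.

Lemma dirichlet_solution_pairing k h y v : (0 < k)%N ->
  dirichlet_solution k h y -> Hk0 k v ->
  int01 (fun x => v x * h x) = int01 (fun x => nderiv01 k v x * nderiv01 k y x).
Proof.
move=> k0 [C P B] [Hv Bv].
pose g i := if (i < 2 * k)%N then nderiv01 i y else fun x => (-1) ^+ k * h x.
have kk : (k + k = 2 * k)%N by lia.
have gk : g k = nderiv01 k y by rewrite /g; have -> : (k < 2 * k)%N by lia.
have g2k : g (2 * k)%N = fun x => (-1) ^+ k * h x by rewrite /g ltnn.
have [_ Ih _] := P.
have H : int01 (fun x => v x * ((-1) ^+ k * h x)) =
    (-1) ^+ k * int01 (fun x => nderiv01 k v x * nderiv01 k y x).
  have := @int01_shift_derivatives (fun i => nderiv01 i v) g k k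
    (Hk_ae_primitive k0 Hv) Bv.
  rewrite kk gk g2k; apply=> i ik; rewrite /g ik; case: ifP => ik'.
    apply: C1_ae_primitive; last by apply: (Cn01_tower C); lia.
    by apply: (Cn01_continuous C); lia.
  by have -> : i = (2 * k).-1 by lia.
rewrite -[RHS]mul1r -[1](sqrr_sign R k) expr2 -mulrA -H -int01Z.
  by apply: eq_int01 => x _; rewrite [in RHS]mulrCA signrMK.
have cv := ae_primitive_continuous (Hk_ae_primitive k0 Hv k0).
by apply: L1_01_eq (L1_01M_continuous Ih cv) => x _; rewrite mulrC.
Qed.

Lemma ae_tower_eq0 k (f : nat -> R -> R) :
  (forall i, (i < k)%N -> ae_primitive (f i) (f i.+1)) ->
  (forall i, (i < k)%N -> f i 0 = 0) ->
  ae01 (fun x => f k x = 0) ->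
  forall i, (i < k)%N -> forall x, 0 <= x <= 1 -> f i x = 0.
Proof.
elim: k => // k IH fp f0 fk.
have H x : 0 <= x <= 1 -> f k x = 0.
  move=> x01; rewrite -(f0 k (ltnSn k)); apply: ae_primitive0_const x01.
  exact: ae_primitive_eq (fp k (ltnSn k)) (L1_01_cst 0) fk.
move=> i; rewrite ltnS leq_eqVlt => /predU1P[->//|ik]; apply: IH ik.
- by move=> j jk; apply: fp; exact: ltnW.
- by move=> j jk; apply: f0; exact: ltnW.
- by apply: ae01W => x x01; apply: H; lra.
Qed.

Lemma dirichlet_solution_congr k h h' y y' :
  (forall x, 0 < x < 1 -> h x = h' x) ->
  (forall x, 0 <= x <= 1 -> y x = y' x) ->
  dirichlet_solution k h y -> dirichlet_solution k h' y'.
Proof.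
move=> hh yy [C P B]; have E := nderiv01_eq yy; split.
- apply: (@tower_Cn01 _ _ (fun i => if i is 0 then y' else nderiv01 i y)).
    move=> [|i] ik x x01; last exact: Cn01_tower C i.+1 ik x x01.
    by apply: has_deriv01_eq (Cn01_tower C ik x01).
  have := Cn01_continuous C (leqnn _); case: (2 * k).-1 => //.
  exact: continuous01_eq.
- by apply: ae_primitive_congr P => x x01; rewrite ?hh// E.
- by move=> j jk; rewrite -!E ?lexx ?ler01//; exact: B.
Qed.

Lemma dirichlet_solution_Hk0 k h y : (0 < k)%N -> dirichlet_solution k h y ->
  Hk0 k y.
Proof.
move=> k0 [C P B]; split=> //.
have tC := Cn01_tower C; have cC := Cn01_continuous C.
split.
- apply: (@tower_Cn01 _ k.-1 (fun i => nderiv01 i y)).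
    by move=> i ik; apply: tC; lia.
  by apply: cC; lia.
- have [kk|kk] := leqP (2 * k).-1 k.-1.
    have -> : k.-1 = (2 * k).-1 by lia.
    by case: P.
  by apply: (C1_abs_cont01 (f' := nderiv01 k.-1.+1 y)); [apply: cC; lia|apply: tC].
- by apply: L2_01_continuous; apply: cC; lia.
Qed.

End dirichlet.

(** * The variational problem *)

Section sign_weight.
Context {R : realType}.
Implicit Types (u v y h : R -> R) (x c t : R).
Variables (k : nat) (rho : R -> R).
Hypothesis k_gt0 : (0 < k)%N.
Hypothesis rho_L1 : L1_01 rho.
Hypothesis rho_ge0 : ae01 (fun x => 0 <= rho x).
Hypothesis rho_neq0 : ~ ae01 (fun x => rho x = 0).

Lemma nondecreasing_sg (x y : R) : x <= y -> Num.sg x <= Num.sg y.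
Proof. by move=> xy; case: (sgrP x); case: (sgrP y) => //; lra. Qed.

Lemma sg_weight_L1 v : {within `[0, 1], continuous v} ->
  L1_01 (fun x => rho x * Num.sg (v x)).
Proof.
move=> cv; apply: (@le_L1_01 _ _ (fun x => `|rho x|)).
- apply: measurable_funM; first exact: L1_01_measurable.
  apply: (@measurableT_comp _ _ _ _ _ _ (Num.sg : R -> R)).
    by apply: nondecreasing_measurable => // x y; exact: nondecreasing_sg.
  exact: continuous01_measurable.
- move=> x _; rewrite normrM ler_piMr//.
  by case: (sgrP (v x)) => _; rewrite ?normrN ?normr1 ?normr0.
- exact: integrable_norm.
Qed.

Lemma abs_weight_L1 v : {within `[0, 1], continuous v} ->
  L1_01 (fun x => `|v x| * rho x).
Proof.
move=> cv; apply: L1_01_eq (L1_01M_continuous (sg_weight_L1 cv) cv) => x _.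
by rewrite -mulrA -normrEsg mulrC.
Qed.

Variable w : R -> R.
Hypothesis w_sol : dirichlet_solution k rho w.

(** For k = 1 and rho = 1 the function [w] is the torsion function of the
    interval and this number its torsional rigidity. *)
Definition torsion : R := int01 (fun x => w x * rho x).

Lemma solution_continuous h y : dirichlet_solution k h y ->
  {within `[0, 1], continuous y}.
Proof. by move=> [C _ _]; exact: (Cn01_continuous C (leq0n _)). Qed.

Lemma Hk0_continuous v : Hk0 k v -> {within `[0, 1], continuous v}.
Proof. by move=> [H _]; exact: ae_primitive_continuous (Hk_ae_primitive k_gt0 H k_gt0). Qed.

Lemma solution_deriv_continuous h y : dirichlet_solution k h y ->
  {within `[0, 1], continuous (nderiv01 k y)}.
Proof. by move=> [C _ _]; apply: (Cn01_continuous C); lia. Qed.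

Let w_gt0 : positive01 w.
Proof. exact: (dirichlet_solution_gt0 k_gt0 w_sol rho_ge0 rho_neq0). Qed.

Lemma weighted_L1 y : {within `[0, 1], continuous y} ->
  L1_01 (fun x => y x * rho x).
Proof.
by move=> cy; apply: L1_01_eq (L1_01M_continuous rho_L1 cy) => x _; rewrite mulrC.
Qed.

Lemma torsion_gt0 : 0 < torsion.
Proof.
have Iw := weighted_L1 (solution_continuous w_sol).
have w0 : ae01 (fun x => 0 <= w x * rho x).
  by apply: ae01S rho_ge0 => x x01; apply: mulr_ge0; exact/ltW/w_gt0.
rewrite lt_neqAle int01_ge0// andbT eq_sym; apply/eqP => T0; apply: rho_neq0.
apply: ae01S (int01_eq0 Iw w0 T0) => x x01 /eqP.
by rewrite mulf_eq0 gt_eqF ?w_gt0// => /eqP.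
Qed.

Lemma solution_energy h y : dirichlet_solution k h y ->
  int01 (fun x => nderiv01 k y x ^+ 2) = int01 (fun x => y x * h x).
Proof.
move=> S; rewrite (dirichlet_solution_pairing k_gt0 S (dirichlet_solution_Hk0 k_gt0 S)).
by apply: eq_int01 => x _; rewrite expr2.
Qed.

Lemma le_sg_weight v : ae01 (fun x => 0 <= rho x - rho x * Num.sg (v x)) /\
  ae01 (fun x => 0 <= rho x + rho x * Num.sg (v x)).
Proof.
by split; apply: ae01S rho_ge0 => x _ r0; case: (sgrP (v x)) => _; lra.
Qed.

(** The comparison principle applies to w - z and w + z, whose right-hand sides
    rho - rho sign(v) and rho + rho sign(v) are nonnegative. *)
Lemma sg_solution_le v z : dirichlet_solution k (fun x => rho x * Num.sg (v x)) z ->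
  forall x, 0 <= x <= 1 -> `|z x| <= w x.
Proof.
move=> z_sol x x01; have [hm hp] := le_sg_weight v.
have := dirichlet_solution_ge0 k_gt0 (dirichlet_solutionB w_sol z_sol) hm x01.
have := dirichlet_solution_ge0 k_gt0 (dirichlet_solutionD w_sol z_sol) hp x01.
by rewrite ler_norml; lra.
Qed.

(** Unless rho sign(v) is rho or - rho almost everywhere, both w - z and w + z
    are solutions for nonzero right-hand sides. *)
Lemma sg_solution_lt v z : dirichlet_solution k (fun x => rho x * Num.sg (v x)) z ->
  ~ ae01 (fun x => rho x * Num.sg (v x) = rho x) ->
  ~ ae01 (fun x => rho x * Num.sg (v x) = - rho x) ->
  forall x, 0 < x < 1 -> `|z x| < w x.
Proof.
move=> z_sol np nm x x01; have [hm hp] := le_sg_weight v.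
have : 0 < w x - z x.
  apply: (dirichlet_solution_gt0 k_gt0 (dirichlet_solutionB w_sol z_sol) hm) x01.
  by move=> H; apply: np; apply: ae01S H => y _; lra.
have : 0 < w x + z x.
  apply: (dirichlet_solution_gt0 k_gt0 (dirichlet_solutionD w_sol z_sol) hp) x01.
  by move=> H; apply: nm; apply: ae01S H => y _; lra.
by rewrite ltr_norml; lra.
Qed.

Lemma weighted_normE v : weighted_norm rho v = int01 (fun x => `|v x| * rho x).
Proof. by []. Qed.

(** The function [z] represents the functional given by the weight rho sign(v),
    whose value at [v] is the weighted norm. *)
Section dual_function.
Variables (v z : R -> R).
Hypothesis v_Hk0 : Hk0 k v.
Hypothesis z_sol : dirichlet_solution k (fun x => rho x * Num.sg (v x)) z.
Local Notation a := (weighted_norm rho v).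
Local Notation E := (int01 (fun x => nderiv01 k v x ^+ 2)).
Local Notation Z := (int01 (fun x => nderiv01 k z x ^+ 2)).

Lemma weighted_norm_pairing :
  a = int01 (fun x => nderiv01 k v x * nderiv01 k z x).
Proof.
rewrite -(dirichlet_solution_pairing k_gt0 z_sol v_Hk0) weighted_normE.
by apply: eq_int01 => x _; rewrite normrEsg; ring.
Qed.

Lemma sg_solution_energy_le : Z <= torsion.
Proof.
rewrite (solution_energy z_sol); apply: le_int01.
- have Iv := sg_weight_L1 (Hk0_continuous v_Hk0).
  apply: L1_01_eq (L1_01M_continuous Iv (solution_continuous z_sol)) => x _.
  by rewrite mulrC.
- exact: weighted_L1 (solution_continuous w_sol).
- apply: ae01S rho_ge0 => x x01 r0.
  have x01' : 0 <= x <= 1 by lra.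
  have := sg_solution_le z_sol x01'; rewrite ler_norml => /andP[zl zr].
  rewrite mulrCA [leRHS]mulrC; apply: ler_wpM2l => //.
  by case: (sgrP (v x)) => _; lra.
Qed.

Lemma sqr_diff_energy t :
  L1_01 (fun x => (nderiv01 k v x - t * nderiv01 k z x) ^+ 2) /\
  int01 (fun x => (nderiv01 k v x - t * nderiv01 k z x) ^+ 2) =
    E - 2 * t * a + t ^+ 2 * Z.
Proof.
have [[_ _ v2] _] := v_Hk0.
have z2 := L2_01_continuous (solution_deriv_continuous z_sol).
have Iv := v2.2; have Iz := z2.2; have Ivz := L2_01M v2 z2.
have I1 := L1_01Z (- (2 * t)) Ivz; have I2 := L1_01Z (t ^+ 2) Iz.
have sq x : nderiv01 k v x ^+ 2 + - (2 * t) * (nderiv01 k v x * nderiv01 k z x)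
    + t ^+ 2 * (nderiv01 k z x ^+ 2) = (nderiv01 k v x - t * nderiv01 k z x) ^+ 2.
  by ring.
split; first by apply: L1_01_eq (L1_01D (L1_01D Iv I1) I2) => x _; exact: sq.
rewrite -(eq_int01 (fun x _ => sq x)) !int01D//; last exact: L1_01D.
by rewrite !int01Z// weighted_norm_pairing mulNr.
Qed.

Lemma weighted_norm_ge0 : 0 <= a.
Proof.
apply: int01_ge0; first exact: abs_weight_L1 (Hk0_continuous v_Hk0).
by apply: ae01S rho_ge0 => x _ r0; rewrite mulr_ge0.
Qed.

(** The energy of v - t z, for the value of t that is optimal when [z] has the
    energy of [w].  Its two deficits to the bound, one from Cauchy-Schwarz and
    one from the comparison of [z] with [w], are treated together. *)
Lemma energy_deficit_ge0 :
  0 <= E - a ^+ 2 / torsion - a ^+ 2 / torsion ^+ 2 * (torsion - Z).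
Proof.
have T0 := torsion_gt0; have [I eqI] := sqr_diff_energy (a / torsion).
have : 0 <= int01 (fun x => (nderiv01 k v x - a / torsion * nderiv01 k z x) ^+ 2).
  by apply: int01_ge0 => //; apply: ae01W => x _; exact: sqr_ge0.
rewrite eqI; congr (_ <= _); field.
by rewrite gt_eqF.
Qed.

Lemma sqr_weighted_norm_le : a ^+ 2 <= E * torsion.
Proof.
have T0 := torsion_gt0.
have D0 : 0 <= a ^+ 2 / torsion ^+ 2 * (torsion - Z).
  by rewrite mulr_ge0 ?divr_ge0 ?sqr_ge0// subr_ge0 sg_solution_energy_le.
rewrite -ler_pdivrMr//; have := energy_deficit_ge0; lra.
Qed.

(** Equality forces [z] to have the energy of [w], hence the sign of [v] to be
    constant where [rho] does not vanish, and forces equality in the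
    Cauchy-Schwarz inequality. *)
Lemma weighted_norm_extremal : a != 0 -> a ^+ 2 = E * torsion ->
  exists2 c, c != 0 & forall x, 0 <= x <= 1 -> v x = c * w x.
Proof.
move=> a0 aE; have T0 := torsion_gt0.
have T0' : torsion != 0 by rewrite gt_eqF.
have Eq : E = a ^+ 2 / torsion by rewrite aE mulfK.
have ZT : Z = torsion.
  apply/eqP; rewrite eq_le sg_solution_energy_le /=.
  have := energy_deficit_ge0; rewrite Eq subrr sub0r oppr_ge0.
  have a_gt0 : 0 < a by rewrite lt_neqAle eq_sym a0 weighted_norm_ge0.
  by rewrite pmulr_rle0 ?subr_le0// divr_gt0 ?exprn_gt0.
have [I eqI] := sqr_diff_energy (a / torsion).
have vz : ae01 (fun x => nderiv01 k v x - a / torsion * nderiv01 k z x = 0).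
  have I0 : int01 (fun x => (nderiv01 k v x - a / torsion * nderiv01 k z x) ^+ 2) = 0.
    by rewrite eqI ZT Eq; field.
  have sq0 : ae01 (fun x => 0 <= (nderiv01 k v x - a / torsion * nderiv01 k z x) ^+ 2).
    by apply: ae01W => x _; exact: sqr_ge0.
  by apply: ae01S (int01_eq0 I sq0 I0) => x _ /eqP; rewrite sqrf_eq0 => /eqP.
have vcz x : 0 <= x <= 1 -> v x = a / torsion * z x.
  move=> x01; apply/eqP; rewrite -subr_eq0; apply/eqP.
  have [Hv Bv] := v_Hk0; have [Hz Bz] := dirichlet_solution_Hk0 k_gt0 z_sol.
  have := @ae_tower_eq0 _ k
    (fun i x => nderiv01 i v x + - (a / torsion) * nderiv01 i z x) _ _ _ 0%N k_gt0 x x01.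
  rewrite /= mulNr; apply.
  - move=> i ik; apply: ae_primitiveD; first exact: Hk_ae_primitive k_gt0 Hv _ ik.
    by apply: ae_primitiveZ; exact: Hk_ae_primitive k_gt0 Hz _ ik.
  - by move=> i ik; have [-> _] := Bv i ik; have [-> _] := Bz i ik; rewrite mulr0 addr0.
  - by apply: ae01S vz => y _; rewrite mulNr.
have c0 : a / torsion != 0 by rewrite mulf_neq0// invr_eq0.
have [Sp|Sp] := pselect (ae01 (fun x => rho x * Num.sg (v x) = rho x)).
  exists (a / torsion) => // x x01; rewrite vcz//; congr (_ * _).
  exact: (dirichlet_solution_unique k_gt0 z_sol w_sol Sp).
have [Sm|Sm] := pselect (ae01 (fun x => rho x * Num.sg (v x) = - rho x)).
  exists (- (a / torsion)) => [|x x01]; first by rewrite oppr_eq0.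
  rewrite vcz// mulNr -mulrN; congr (_ * _); rewrite -mulN1r.
  apply: (dirichlet_solution_unique k_gt0 z_sol (dirichlet_solutionZ (-1) w_sol)) => //.
  by apply: ae01S Sm => y _ ->; rewrite mulN1r.
exfalso; apply: rho_neq0.
have lt := sg_solution_lt z_sol Sp Sm.
have Iv := sg_weight_L1 (Hk0_continuous v_Hk0).
have Iz : L1_01 (fun x => z x * (rho x * Num.sg (v x))).
  apply: L1_01_eq (L1_01M_continuous Iv (solution_continuous z_sol)) => x _.
  by rewrite mulrC.
have Iw := weighted_L1 (solution_continuous w_sol).
have gap x : 0 < x < 1 -> 0 < w x - z x * Num.sg (v x).
  move=> x01; have := lt x x01; have := w_gt0 x01.
  by rewrite ltr_norml => w0 /andP[zl zr]; case: (sgrP (v x)) => _; lra.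
have pos : ae01 (fun x => 0 <= w x * rho x - z x * (rho x * Num.sg (v x))).
  apply: ae01S rho_ge0 => x x01 r0; have := gap x x01; nra.
have : int01 (fun x => w x * rho x - z x * (rho x * Num.sg (v x))) = 0.
  by rewrite int01B// -(solution_energy z_sol) ZT subrr.
move=> /(int01_eq0 (L1_01B Iw Iz) pos); apply: ae01S => x x01.
have -> : w x * rho x - z x * (rho x * Num.sg (v x)) =
    (w x - z x * Num.sg (v x)) * rho x by ring.
by move=> /eqP; rewrite mulf_eq0 gt_eqF ?gap// => /eqP.
Qed.

End dual_function.

End sign_weight.

(** * The eigenvalue problem *)

Section eigenvalue_problem.
Context {R : realType}.
Implicit Types (u v y h : R -> R) (x c t mu nu : R) (P : R -> Prop).
Notation leb := (@lebesgue_measure R).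
Variables (k : nat) (rho : R -> R).
Hypothesis k_gt0 : (0 < k)%N.
Hypothesis rho_L1 : L1_01 rho.
Hypothesis rho_ge0 : ae01 (fun x => 0 <= rho x).
Hypothesis rho_neq0 : ~ ae01 (fun x => rho x = 0).

Lemma eigenfunction_solution nu v : is_eigenfunction k rho nu v ->
  dirichlet_solution k (fun x => nu * (rho x * Num.sg (v x))) v.
Proof.
move=> [[C A] eq _ B]; split=> //; split=> //.
  apply/L1_01Z/L1_01Z/sg_weight_L1 => //.
  exact: (Cn01_continuous C (leq0n _)).
have k2 : (2 * k = (2 * k).-1.+1)%N by lia.
move: eq; rewrite k2 /= => eq; apply: (@filterS _ _ (ae_filter_ringOfSetsType leb)) eq.
move=> x H x01; have [|/derivable01_has dx dE] := H; first by lra.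
suff -> : (-1) ^+ k * (nu * (rho x * Num.sg (v x))) = deriv01 (nderiv01 (2 * k).-1 v) x.
  exact: dx.
by rewrite mulrA -dE signrMK.
Qed.

Lemma solution_eigenfunction nu v h : dirichlet_solution k h v ->
  (forall x, 0 < x < 1 -> h x = nu * rho x * Num.sg (v x)) ->
  weighted_norm rho v = 1 -> is_eigenfunction k rho nu v.
Proof.
move=> [C [A _ D] B] hE v1; split=> //.
have k2 : (2 * k = (2 * k).-1.+1)%N by lia.
have ne c : {ae leb, forall x, x != c}.
  exists [set c]; split; first exact: measurable_set1.
    by rewrite [LHS]lebesgue_measure_set1.
  by move=> x /= /negP; rewrite negbK => /eqP.
apply: (@filterS3 _ _ (ae_filter_ringOfSetsType leb)) (ne 0) (ne 1) D.
move=> x x0 x1 H x01.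
have x01' : 0 < x < 1 by rewrite !lt_neqAle [0 == x]eq_sym x0 x1.
have {}H := H x01'; rewrite k2; split; first exact: has_deriv01_derivable H.
by rewrite /= (has_deriv01E x01 H) signrMK -hE.
Qed.

Lemma eigenvalue_energy nu v : is_eigenfunction k rho nu v ->
  Hk0 k v /\ int01 (fun x => nderiv01 k v x ^+ 2) = nu.
Proof.
move=> ev; have S := eigenfunction_solution ev; have [_ _ v1 _] := ev.
split; first exact: dirichlet_solution_Hk0 S.
rewrite (solution_energy k_gt0 S) -[RHS]mulr1 -v1 weighted_normE -int01Z.
  by apply: eq_int01 => x _; rewrite normrEsg; ring.
exact: (abs_weight_L1 rho_L1 (solution_continuous S)).
Qed.

Variable w : R -> R.
Hypothesis w_sol : dirichlet_solution k rho w.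
Local Notation N := (torsion rho w).

Let N_gt0 : 0 < N. Proof. exact: torsion_gt0 w_sol. Qed.

Let w_gt0 : positive01 w.
Proof. exact: (dirichlet_solution_gt0 k_gt0 w_sol rho_ge0 rho_neq0). Qed.

Lemma weighted_norm_scale c v : (forall x, 0 <= x <= 1 -> v x = c * w x) ->
  weighted_norm rho v = `|c| * N.
Proof.
move=> vE; rewrite weighted_normE -int01Z.
  apply: eq_int01 => x x01; rewrite vE; last lra.
  by rewrite normrM (gtr0_norm (w_gt0 x01)) mulrA.
exact: weighted_L1 (solution_continuous w_sol).
Qed.

Lemma scale_solution c v : (forall x, 0 <= x <= 1 -> v x = c * w x) ->
  dirichlet_solution k (fun x => c * rho x) v.
Proof.
move=> vE; apply: dirichlet_solution_congr (dirichlet_solutionZ c w_sol) => //.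
by move=> x x01; rewrite vE.
Qed.

Lemma scale_energy c v : (forall x, 0 <= x <= 1 -> v x = c * w x) ->
  int01 (fun x => nderiv01 k v x ^+ 2) = c ^+ 2 * N.
Proof.
move=> vE; rewrite (solution_energy k_gt0 (scale_solution vE)) -int01Z.
  by apply: eq_int01 => x x01; rewrite vE; [ring|lra].
exact: weighted_L1 (solution_continuous w_sol).
Qed.

Lemma positive_eigenfunction :
  is_eigenfunction k rho N^-1 (fun x => N^-1 * w x) /\
  positive01 (fun x => N^-1 * w x).
Proof.
have pos : positive01 (fun x => N^-1 * w x).
  by move=> x x01; rewrite mulr_gt0 ?invr_gt0 ?w_gt0.
split=> //; apply: (solution_eigenfunction (dirichlet_solutionZ N^-1 w_sol)).
  by move=> x x01; rewrite gtr0_sg ?mulr1// pos.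
rewrite (weighted_norm_scale (c := N^-1))// gtr0_norm ?invr_gt0// mulVf//.
by rewrite gt_eqF.
Qed.

(** The equation of a positive eigenfunction is linear, so [v] is [nu] times [w];
    the normalisation determines [nu]. *)
Lemma positive_eigenfunction_unique nu v : is_eigenfunction k rho nu v ->
  positive01 v -> nu = N^-1 /\ forall x, 0 <= x <= 1 -> v x = N^-1 * w x.
Proof.
move=> ev v0; have [_ _ v1 _] := ev.
have vE x : 0 <= x <= 1 -> v x = nu * w x.
  apply: (dirichlet_solution_unique k_gt0 (eigenfunction_solution ev)
    (dirichlet_solutionZ nu w_sol)) => //.
  by apply: ae01W => t t01; rewrite gtr0_sg ?mulr1// v0.
suff nuE : nu = N^-1 by rewrite -nuE.
have half : 0 < (1 / 2 : R) < 1 by lra.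
have nu0 : 0 < nu.
  have := v0 _ half; rewrite vE; last lra.
  by rewrite pmulr_lgt0// w_gt0.
have := v1; rewrite (weighted_norm_scale vE) gtr0_norm// => nuN.
by apply: (mulIf (lt0r_neq0 N_gt0)); rewrite nuN mulVf// gt_eqF.
Qed.

Lemma eigenvalue_ge nu v : is_eigenfunction k rho nu v -> N^-1 <= nu.
Proof.
move=> ev; have [v_Hk0 E] := eigenvalue_energy ev; have [_ _ v1 _] := ev.
have [z z_sol] := ex_dirichlet_solution k_gt0 (sg_weight_L1 rho_L1 (Hk0_continuous k_gt0 v_Hk0)).
have := sqr_weighted_norm_le k_gt0 rho_L1 rho_ge0 rho_neq0 w_sol v_Hk0 z_sol.
by rewrite E v1 expr1n -ler_pdivrMr// mul1r.
Qed.

Lemma norm_quotientE v : norm_quotient k rho v =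
  if weighted_norm rho v == 0 then +oo%E else
  (Num.sqrt (int01 (fun x => nderiv01 k v x ^+ 2)) / weighted_norm rho v)%:E.
Proof.
rewrite /norm_quotient; case: ifP => // _.
congr ((Num.sqrt _ / _)%:E); apply: eq_Rintegral => x _.
by rewrite real_normK// num_real.
Qed.

Lemma norm_quotient_ge v : Hk0 k v -> ((Num.sqrt N)^-1%:E <= norm_quotient k rho v)%E.
Proof.
move=> v_Hk0; rewrite norm_quotientE; case: eqP => [_|/eqP a0]; first by rewrite leey.
have [z z_sol] := ex_dirichlet_solution k_gt0 (sg_weight_L1 rho_L1 (Hk0_continuous k_gt0 v_Hk0)).
have := sqr_weighted_norm_le k_gt0 rho_L1 rho_ge0 rho_neq0 w_sol v_Hk0 z_sol.
have := weighted_norm_ge0 k_gt0 rho_L1 rho_ge0 v_Hk0.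
rewrite le_eqVlt eq_sym (negbTE a0) /= => a_gt0 aE.
rewrite lee_fin ler_pdivlMr// mulrC ler_pdivrMr ?sqrtr_gt0//.
rewrite -sqrtrM; last by apply: int01_ge0; [have [[_ _ []]] := v_Hk0|apply: ae01W => x _; exact: sqr_ge0].
by rewrite -[leLHS](ger0_norm (ltW a_gt0)) -sqrtr_sqr ler_wsqrtr.
Qed.

Lemma scale_norm_quotient c v : c != 0 -> (forall x, 0 <= x <= 1 -> v x = c * w x) ->
  [/\ Hk0 k v, nonzero01 v & norm_quotient k rho v = (Num.sqrt N)^-1%:E].
Proof.
move=> c0 vE; split.
- exact: dirichlet_solution_Hk0 (scale_solution vE).
- exists (1 / 2); first lra.
  have h : 0 < (1 / 2 : R) < 1 by lra.
  by rewrite vE; [rewrite mulf_neq0// gt_eqF// w_gt0|lra].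
- have s0 : Num.sqrt N != 0 by rewrite gt_eqF ?sqrtr_gt0.
  have c0' : `|c| != 0 by rewrite normr_eq0.
  rewrite norm_quotientE (weighted_norm_scale vE) (scale_energy vE).
  rewrite mulf_eq0 normr_eq0 (negbTE c0) gt_eqF//=.
  rewrite sqrtrM ?sqr_ge0// sqrtr_sqr; congr EFin.
  by rewrite -[in X in _ / X](sqr_sqrtr (ltW N_gt0)); field; rewrite s0.
Qed.

Lemma inf_quotientE : inf_quotient k rho = (Num.sqrt N)^-1%:E.
Proof.
apply/eqP; rewrite eq_le; apply/andP; split.
  have [|H1 H2 <-] := @scale_norm_quotient 1 (fun x => 1 * w x) (oner_neq0 _) => //.
  by apply: ereal_inf_lbound; exists (fun x => 1 * w x).
apply: le_ereal_inf_tmp => _ [v [v_Hk0 _] <-].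
exact: norm_quotient_ge.
Qed.

Lemma minimizerP v : is_minimizer k rho v <->
  exists2 c, c != 0 & forall x, 0 <= x <= 1 -> v x = c * w x.
Proof.
split=> [[v_Hk0 _]|[c c0 vE]]; last first.
  have [H1 H2 H3] := scale_norm_quotient c0 vE.
  by split=> //; rewrite H3 inf_quotientE.
rewrite inf_quotientE norm_quotientE; case: eqP => // /eqP a0 [] qE.
have [z z_sol] := ex_dirichlet_solution k_gt0 (sg_weight_L1 rho_L1 (Hk0_continuous k_gt0 v_Hk0)).
apply: (weighted_norm_extremal k_gt0 rho_L1 rho_ge0 rho_neq0 w_sol v_Hk0 z_sol a0).
have E0 : 0 <= int01 (fun x => nderiv01 k v x ^+ 2).
  by apply: int01_ge0; [have [[_ _ []]] := v_Hk0|apply: ae01W => x _; exact: sqr_ge0].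
have s0 : Num.sqrt N != 0 by rewrite gt_eqF ?sqrtr_gt0.
rewrite -(sqr_sqrtr E0) -[N in RHS](sqr_sqrtr (ltW N_gt0)) -exprMn; congr (_ ^+ 2).
by rewrite -[in RHS](divfK a0 (Num.sqrt (int01 _))) qE mulrAC mulVf// mul1r.
Qed.

Lemma scale_constant_sign c v : c != 0 ->
  (forall x, 0 <= x <= 1 -> v x = c * w x) -> positive01 v \/ negative01 v.
Proof.
rewrite neq_lt => /orP[c_lt0|c_gt0] vE; [right|left] => x x01.
  rewrite vE; last lra.
  by rewrite nmulr_rlt0// w_gt0.
rewrite vE; last lra.
by rewrite pmulr_rgt0// w_gt0.
Qed.

Lemma LambdaE : (((Lambda k rho)^-1) ^+ 2)%E = N^-1%:E.
Proof.
have s0 : Num.sqrt N != 0 by rewrite gt_eqF ?sqrtr_gt0.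
rewrite /Lambda inf_quotientE inver invr_eq0 (negbTE s0) invrK inver (negbTE s0).
by rewrite -EFin_expe exprVn sqr_sqrtr// ltW.
Qed.

End eigenvalue_problem.

Theorem theorem1 (R : realType) (k : nat) (rho : R -> R)
  (k_ge1 : (1 <= k)%N)
  (rho_L1 : L1_01 rho)
  (rho_ge0 : {ae @lebesgue_measure R, forall x : R, 0 < x < 1 -> 0 <= rho x})
  (rho_neq0 :
    ~ {ae @lebesgue_measure R, forall x : R, 0 < x < 1 -> rho x = 0}) :
  exists (mu : R) (u : R -> R),
    ((is_eigenfunction k rho mu u /\ positive01 u) /\
     (forall (nu : R) (v : R -> R),
        is_eigenfunction k rho nu v -> positive01 v ->
        nu = mu /\ (forall x : R, 0 <= x <= 1 -> v x = u x))) /\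
    (is_eigenvalue k rho mu /\
     (forall nu : R, is_eigenvalue k rho nu -> mu <= nu)) /\
    ((exists v : R -> R, is_minimizer k rho v) /\
     (forall v : R -> R, is_minimizer k rho v <->
        (exists2 c : R, c != 0 & forall x : R, 0 <= x <= 1 -> v x = c * u x)) /\
     (forall v : R -> R, is_minimizer k rho v -> positive01 v \/ negative01 v)) /\
    mu%:E = (((Lambda k rho)^-1) ^+ 2)%E.
Proof.
have [w w_sol] := ex_dirichlet_solution k_ge1 rho_L1.
have [u_eig u_pos] := positive_eigenfunction k_ge1 rho_L1 rho_ge0 rho_neq0 w_sol.
have min := minimizerP k_ge1 rho_L1 rho_ge0 rho_neq0 w_sol.
have N0 : torsion rho w != 0.
  by rewrite gt_eqF// (torsion_gt0 k_ge1 rho_L1 rho_ge0 rho_neq0 w_sol).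
exists (torsion rho w)^-1, (fun x => (torsion rho w)^-1 * w x).
split; first split=> //.
  by move=> nu v; exact: (positive_eigenfunction_unique k_ge1 rho_L1 rho_ge0 rho_neq0 w_sol).
split; first split.
- by exists (fun x => (torsion rho w)^-1 * w x).
- by move=> nu [v]; exact: (eigenvalue_ge k_ge1 rho_L1 rho_ge0 rho_neq0 w_sol).
split; last by rewrite (LambdaE k_ge1 rho_L1 rho_ge0 rho_neq0 w_sol).
split; first by exists (fun x => 1 * w x); apply/min; exists 1; rewrite ?oner_neq0.
split=> v; last first.
  move=> /min[c c0]; exact: (scale_constant_sign k_ge1 rho_ge0 rho_neq0 w_sol c0).
(* minimizers are given as multiples of [w] and [u] is [w] over its torsion *)
split=> [/min[c c0 vE]|[c c0 vE]].
  exists (c * torsion rho w); first by rewrite mulf_neq0.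
  by move=> x x01; rewrite vE// mulrA mulfK.
apply/min; exists (c * (torsion rho w)^-1); first by rewrite mulf_neq0// invr_neq0.
by move=> x x01; rewrite vE// mulrA.
Qed.
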